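(* Let $g:\mathbb{R}\to\mathbb{R}$ be a function of class $\mathcal{C}^2$ satisfying conditions (A1)–(A4) listed in the context, with $\tau\in(0,1)$ the number appearing in (A4), and let $F$ be the distribution function with density $p(x)=c_1e^{-G(x)}$, $G(x)=\int_0^x g(t)\,dt$. Let $\mathbf{X}$ be a random vector in $\mathbb{R}^n$, let $W=\varphi(\mathbf{X})$ for a measurable function $\varphi$, and let $(W,W')$ be an exchangeable pair, $\Delta=W-W'$. Assume that $$E(\Delta\mid \mathbf{X})=\lambda\,(g(W)+R)\quad\text{a.s.}$$ for some constant $\lambda\in(0,1)$ and some random variable $R$, and that $E g^2(W)<\infty$. Let $\Delta^*=\Delta^*(W,W')$ be any random variable such that $\Delta^*(W,W')=\Delta^*(W',W)$ and $\Delta^*\ge|\Delta|$ a.s. Then there is a constant $C$ which, for fixed $g$, depends only on $\tau$ and $Eg^2(W)$, such that for every $z\in\mathbb{R}$, $$\big|P(W\le z)-F(z)\big|\le\frac{C}{1+|g(z)|}\left\{\sqrt{E\Big|1-\frac{1}{2\lambda}E(\Delta^2\mid\mathbf{X})\Big|^2}+\frac{1}{\lambda}\sqrt{E\big|E(\Delta\Delta^*\mid\mathbf{X})\big|^2}+E|R|\right\}.$$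
   Context: A pair $(W,W')$ of random variables is exchangeable if $(W,W')$ and $(W',W)$ have the same distribution. Conditions on $g$: (A1) $g$ is non-decreasing and $xg(x)\ge 0$ for all $x\in\mathbb{R}$. (A2) $g'$ is continuous and $2(g'(x))^2-g(x)g''(x)\ge 0$ for all $x\in\mathbb{R}$. (A3) $\lim_{x\to-\infty}g(x)p(x)=0$ and $\lim_{x\to+\infty}g(x)p(x)=0$, where $p(x)=c_1e^{-G(x)}$, $G(x)=\int_0^x g(t)\,dt$, and $c_1>0$ is the constant such that $\int_{-\infty}^{+\infty}p(x)\,dx=1$ (in particular $e^{-G}$ is assumed integrable). (A4) There are a number $\tau\in(0,1)$ and a positive constant $K_\tau$ such that $\dfrac{g(x)}{g(\tau x)}\le K_\tau$ for all $x\in\mathbb{R}$, understood as $|g(x)|\le K_\tau|g(\tau x)|$ for all $x$ (so that $0/0$, e.g. at $x=0$, is allowed). *)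

(* Defs.v *)
From HB Require Import structures.
From mathcomp Require Export all_boot all_order all_algebra.
From mathcomp Require Export all_classical all_reals all_analysis.
From mathcomp Require Export measurable_realfun.
Export Order.TTheory GRing.Theory Num.Theory.
Export numFieldNormedType.Exports.

Set Implicit Arguments.
Unset Strict Implicit.
Unset Printing Implicit Defensive.

Local Open Scope classical_set_scope.
Local Open Scope ring_scope.

Section conditions_on_g.
Context {R : realType}.
Implicit Types (g : R -> R) (x z : R).

Definition class_C2 g : Prop :=
  [/\ forall x, derivable g x 1,
      forall x, derivable (derive1 g) x 1 &
      continuous (derive1n 2 g)].

(* The oriented integral of g from 0 to x. *)
Definition potential g x : R :=
  if 0 <= x then \int[lebesgue_measure]_(t in `[0, x]) g t
  else - \int[lebesgue_measure]_(t in `[x, 0]) g t.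

Definition density g (c1 : R) x : R := c1 * expR (- potential g x).

(* The extended-real integral being 1 includes the integrability of
   expR (- potential g). *)
Definition normalizing g (c1 : R) : Prop :=
  0 < c1 /\ (\int[lebesgue_measure]_x (density g c1 x)%:E = 1)%E.

Definition distr_fun g (c1 : R) z : R :=
  \int[lebesgue_measure]_(x in `]-oo, z]) density g c1 x.

Definition condA1 g : Prop :=
  {homo g : x y / x <= y} /\ forall x, 0 <= x * g x.

Definition condA2 g : Prop :=
  continuous (derive1 g) /\
  forall x, 0 <= 2 * (derive1 g x) ^+ 2 - g x * derive1n 2 g x.

Definition condA3 g (c1 : R) : Prop :=
  (g x * density g c1 x @[x --> -oo] --> (0 : R)) /\
  (g x * density g c1 x @[x --> +oo] --> (0 : R)).

Definition condA4 g (tau : R) : Prop :=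
  0 < tau < 1 /\
  exists2 K : R, 0 < K & forall x, `|g x| <= K * `|g (tau * x)|.

End conditions_on_g.

Definition exchangeable d (T : measurableType d) (R : realType)
    (P : probability T R) (U V : T -> R) : Prop :=
  forall A : set (R * R), measurable A ->
    pushforward P (fun w => (U w, V w)) A =
    pushforward P (fun w => (V w, U w)) A.

(* Z is a version of the conditional expectation of Y given the sigma-algebra
   generated by X.  Y has to be integrable or nonnegative; in the second case
   E Y may be infinite, hence the extended-real values of Z. *)
Definition is_cond_expectation d d' (T : measurableType d)
    (T' : measurableType d') (R : realType) (P : probability T R)
    (X : T -> T') (Y : T -> R) (Z : T -> \bar R) : Prop :=
  [/\ measurable_fun [set: T] Y,
      P.-integrable [set: T] (EFin \o Y) \/ (forall w, 0 <= Y w),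
      measurable_fun [set: g_sigma_algebra_preimageType X] Z &
      forall A : set T, g_sigma_algebra_preimage X A ->
        (\int[P]_(w in A) Z w = \int[P]_(w in A) (Y w)%:E)%E].

(* Main.v *)
Require Import Defs.
From mathcomp Require Import ring lra.

Set Implicit Arguments.
Unset Strict Implicit.
Unset Printing Implicit Defensive.

Local Open Scope classical_set_scope.
Local Open Scope ring_scope.

(** The proof is Stein's method with exchangeable pairs, made non-uniform by
    weighting every estimate with [1 + |g z|].

    Let [p] be the density, so that [p' = - g p], and [F] its distribution
    function.  The equation [f' - g f = 1_(-oo, z] - F z] has the solution that
    equals [(F / p) (1 - F z)] to the left of [z] and [((1 - F) / p) (F z)] to
    the right.  Integrating the equation against the law of [W] turns
    [P (W <= z) - F z] into [E (f' W - g W f W)].  Exchangeability gives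
    [2 E (Delta f(W)) = E (Delta (f W - f W'))], the left side being
    [2 lambda E ((g W + R) f W)] by the regression hypothesis.  Expanding the
    right side to first order leaves three errors:
    - [E (f'(W) (1 - Delta^2 / (2 lambda)))], which is the first term;
    - the Taylor remainder.  Here [f' = h + k] with [h := g f] nondecreasing and
      [k := 1_(-oo, z] - F z] nonincreasing, hence the remainder is at most
      [Delta (H W - H W')] with [H := h - k] (lemma [stein_f_increment_bound]).
      As [Delta*] is symmetric and dominates [|Delta|], multiplying by it and
      using exchangeability turns this bound into [2 E (Delta Delta* H(W))],
      the second term;
    - [E (R f(W))], the third term.

    Monotonicity of [h] is where the condition [2 g'^2 - g g'' >= 0] enters: it
    makes [F + g p / (g' + g^2)] nondecreasing where [g < 0], and this function
    tends to [0] at [-oo], which yields exactly the sign of the derivative of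
    [g F / p] (lemmas [lower_tail_ge] and [g_mills_lower_nd]).

    The weight [1 + |g z|] is won as follows.  For [z >= 0], the function [f] is
    largest at [z], where it is at most of order [1 / g z].  The functions [h]
    and [k] are of that order only on [w <= tau z], because [1 - F z] and
    [p z / p (tau z)] are (lemmas [upper_tail_weight] and
    [stein_h_tau_weight]); beyond [tau z] they are merely bounded, but there
    [|g w| >= |g z| / K].  Both regimes are covered by the single bound
    [|h w| + |k w| <= B (1 + |g w|)] with [B] of order [1 / (1 + |g z|)]
    (lemma [stein_h_growth]), and the factor [1 + |g W|] is absorbed by the
    Cauchy-Schwarz inequality and [E g(W)^2 = m].

    Negative [z] reduces to positive [z] by the reflection [x |-> - x], which
    exchanges [F] and [1 - F] and exchanges closed and open half-lines.  *)

(** * Derivatives and monotonicity *)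
Lemma mean_value (R : realType) (f df : R -> R) (a b : R) : a <= b ->
  (forall x, a <= x <= b -> is_derive x 1 f (df x)) ->
  exists2 c, a <= c <= b & f b - f a = df c * (b - a).
Proof.
move=> ab dfE.
have [x||c cab fE] := @MVT_segment R f df a b ab.
- by move=> xab; apply: dfE; rewrite !(itvP xab).
- apply: derivable_within_continuous => x xab.
  have [] // := dfE x _; by rewrite !(itvP xab).
by exists c => //; rewrite !(itvP cab).
Qed.

Lemma derive_ge0_le (R : realType) (f df : R -> R) (a b : R) : a <= b ->
  (forall x, a <= x <= b -> is_derive x 1 f (df x)) ->
  (forall x, a <= x <= b -> 0 <= df x) -> f a <= f b.
Proof.
move=> ab dfE df0; have [c cab] := mean_value ab dfE.
by move=> fE; rewrite -subr_ge0 fE mulr_ge0 ?df0 // subr_ge0.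
Qed.

(** * Mills ratios of the density *)

(** The analytic data of the problem, with [g1] and [g2] the first two
    derivatives of [g].  Every field is invariant under the reflection of
    [stein_setup_reflect]; to that end the limits of [F] at infinity are
    recorded in the form of [F_inf] and [F_sup]. *)
Record stein_setup (R : realType) (g g1 g2 p F : R -> R) (tau K : R) : Prop := {
  g_nd : {homo g : x y / x <= y};
  g_sign : forall x : R, 0 <= x * g x;
  g_diff : forall x : R, is_derive x 1 g (g1 x);
  g1_diff : forall x : R, is_derive x 1 g1 (g2 x);
  g_convex : forall x : R, 0 <= 2 * g1 x ^+ 2 - g x * g2 x;
  tau_itv : 0 < tau < 1;
  K_gt0 : 0 < K;
  g_tau : forall x : R, `|g x| <= K * `|g (tau * x)|;
  p_gt0 : forall x : R, 0 < p x;
  p_diff : forall x : R, is_derive x 1 p (- (g x * p x));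
  F_diff : forall x : R, is_derive x 1 F (p x);
  F_itv : forall x : R, 0 <= F x <= 1;
  F_inf : forall e, 0 < e -> exists x, F x < e;
  F_sup : forall e, 0 < e -> exists x, 1 - F x < e }.

Lemma is_derive_reflect (R : realType) (f : R -> R) (x df : R) :
  is_derive (- x) 1 f df -> is_derive x 1 (fun y => f (- y)) (- df).
Proof.
move=> dfE; have -> : (fun y => f (- y)) = f \o -%R by [].
apply: is_derive_eq.
by rewrite mulrN mulr1.
Qed.

Lemma stein_setup_reflect (R : realType) (g g1 g2 p F : R -> R) (tau K : R) :
  stein_setup g g1 g2 p F tau K ->
  stein_setup (fun x => - g (- x)) (fun x => g1 (- x)) (fun x => - g2 (- x))
    (fun x => p (- x)) (fun x => 1 - F (- x)) tau K.
Proof.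
case=> gnd gs dg dg1 gc t01 K0 gt p0 dp dF F01 Fi Fs; split=> //.
- by move=> x y xy; rewrite lerN2 gnd// lerN2.
- by move=> x; have := gs (- x); rewrite mulrN mulNr.
- move=> x; rewrite -[g1 _]opprK.
  exact/is_deriveN/is_derive_reflect.
- by move=> x; apply: is_derive_reflect.
- by move=> x; rewrite mulrNN.
- by move=> x; rewrite !normrN -mulrN.
- by move=> x; rewrite mulNr; apply: is_derive_reflect.
- move=> x; rewrite -[p _]opprK -[X in is_derive _ _ _ X]add0r.
  apply: is_deriveB. exact: is_derive_reflect.
- by move=> x; have := F01 (- x); lra.
- by move=> e /Fs[x xe]; exists (- x); rewrite opprK.
- by move=> e /Fi[x xe]; exists (- x); rewrite opprK; lra.
Qed.

Definition mills_lower (R : realType) (p F : R -> R) (w : R) := F w / p w.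
Definition mills_upper (R : realType) (p F : R -> R) (w : R) := (1 - F w) / p w.

Section stein.
Context {R : realType} {g g1 g2 p F : R -> R} {tau K : R}.
Hypothesis S : stein_setup g g1 g2 p F tau K.

Lemma F_nondecreasing : {homo F : x y / x <= y}.
Proof.
move=> x y xy; apply: (derive_ge0_le xy) => [u _|u _]; first exact: F_diff S u.
exact/ltW/(p_gt0 S).
Qed.

Lemma F_gt0 x : 0 < F x.
Proof.
have [c cx FE] := @mean_value _ F p (x - 1) x ltac:(lra) (fun u _ => F_diff S u).
have := F_itv S (x - 1); have := p_gt0 S c; nra.
Qed.

(** For fixed [w], [p y + g w * F y] has the derivative [(g w - g y) * p y],
    which is nonnegative for [y <= w], and its lower limit at [-oo] is at
    least [0]. *)
Lemma lower_tail_le w : - g w * F w <= p w.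
Proof.
have h y : y <= w -> g w * F y <= p w + g w * F w.
  move=> yw; rewrite (@le_trans _ _ (p y + g w * F y))//.
    by have := p_gt0 S y; lra.
  apply: (@derive_ge0_le _ (fun y => p y + g w * F y) (fun y => (g w - g y) * p y)) => // u uw.
    have dp := p_diff S u; have dF := F_diff S u.
    apply: is_derive_eq.
    by rewrite /GRing.scale /=; ring.
  by rewrite mulr_ge0 ?(ltW (p_gt0 S u))// subr_ge0 (g_nd S)//; case/andP: uw.
rewrite leNgt; apply/negP => pw.
have gw : g w < 0 by have := p_gt0 S w; have := F_gt0 w; nra.
have e0 : 0 < (- g w * F w - p w) / - g w by rewrite divr_gt0; lra.
have [x Fx] := F_inf S e0.
have : F x * - g w < - g w * F w - p w by rewrite -ltr_pdivlMr; lra.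
have [xw|/ltW wx] := leP x w; first by have := h x xw; lra.
have := F_nondecreasing wx; have := p_gt0 S w; nra.
Qed.

Let M := mills_lower p F.

(** As [M' - g M = 1], the function [M (1 - F z)] solves the Stein equation to
    the left of [z]. *)
Lemma mills_lower_diff (w : R) : is_derive w 1 M (1 + g w * M w).
Proof.
have p0 : p w != 0 by rewrite gt_eqF// (p_gt0 S).
have dp := p_diff S w; have dF := F_diff S w.
rewrite /M /mills_lower.
apply: is_derive_eq.
rewrite /GRing.scale /=; field.
exact: p0.
Qed.

Lemma mills_lower_nd : {homo M : x y / x <= y}.
Proof.
move=> x y xy; apply: (derive_ge0_le xy) => [u _|u _]; first exact: mills_lower_diff.
have p0 := p_gt0 S u.
have -> : 1 + g u * M u = (p u - - g u * F u) / p u by rewrite /M /mills_lower; field; lra.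
by rewrite divr_ge0 ?(ltW p0)// subr_ge0 lower_tail_le.
Qed.

(** Where [g] is nonpositive the density increases, so the mass
    between [y] and [y + 1] is at least [p y].  This gives the decay of [p] at [-oo]. *)
Lemma density_le_F y : g (y + 1) <= 0 -> p y <= F (y + 1).
Proof.
move=> gy.
have [c cy FE] := @mean_value _ F p y (y + 1) ltac:(lra) (fun u _ => F_diff S u).
have := F_itv S y.
have : p y <= p c; last by lra.
apply: (@derive_ge0_le _ p (fun u => - (g u * p u))) => [|u _|u uy].
- lra.
- exact: p_diff S u.
have : g u <= 0 by rewrite (le_trans _ gy)// (g_nd S)//; lra.
by have := p_gt0 S u; nra.
Qed.

(** Adding [e * x] makes [g] strictly increasing, which is the form needed to
    read off the sign of the derivative. *)
Lemma g1_ge0 x : 0 <= g1 x.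
Proof.
apply/ler_addgt0Pr => e e0.
have dg u : is_derive u (1 : R) (fun x => g x + e * x) (g1 u + e).
  have dg := g_diff S u.
  by apply: is_derive_eq; rewrite /GRing.scale /=; ring.
have -> : g1 x + e = derive1 (fun x => g x + e * x) x.
  by rewrite derive1E; have -> := @derive_val _ _ _ _ _ _ _ (dg x).
apply: (@incr_derive1_ge0 _ _ setT) => //.
- by move=> u v _ _ uv; rewrite ler_ltD ?(g_nd S)// ?ltW// ltr_pM2l.
- by rewrite interiorT.
Qed.

(** Second-order lower bound for the tail [F w], complementary to
    [lower_tail_le].  The difference [H := F + g p / (g1 + g^2)] has the
    derivative [p (2 g1^2 - g g2) / (g1 + g^2)^2 >= 0], and [H >= - p / |g w|]
    to the left of [w], which vanishes at [-oo]. *)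
Lemma lower_tail_ge w : g w < 0 -> - g w * p w <= (g1 w + g w ^+ 2) * F w.
Proof.
move=> gw0.
have gneg y : y <= w -> g y <= g w by exact: (g_nd S).
have D0 y : y <= w -> 0 < g1 y + g y ^+ 2.
  by move=> /gneg gy; have := g1_ge0 y; nra.
pose H y := F y + g y * p y / (g1 y + g y ^+ 2).
pose dH y := p y * (2 * g1 y ^+ 2 - g y * g2 y) / (g1 y + g y ^+ 2) ^+ 2.
have H_nd y : y <= w -> H y <= H w.
  move=> yw; apply: (@derive_ge0_le _ H dH) => // u /andP[_ uw].
    have n0 : g1 u + g u ^+ 2 != 0 by rewrite gt_eqF// D0.
    have dp := p_diff S u; have dF := F_diff S u.
    have dg := g_diff S u; have dg1 := g1_diff S u.
    apply: is_derive_eq.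
    by rewrite /GRing.scale /dH /=; field.
  rewrite /dH !mulr_ge0 ?(ltW (p_gt0 S u)) ?(g_convex S)// invr_ge0.
  by rewrite exprn_ge0// ltW// D0.
have H0 : 0 <= H w.
  rewrite leNgt; apply/negP => Hw.
  have /(F_inf S)[x Fx] : 0 < - H w * - g w by rewrite mulr_gt0; lra.
  (* shifted by 1 because [p y] is compared with [F (y + 1)] *)
  pose y := Num.min x w - 1.
  have yx : y + 1 <= x by rewrite /y subrK ge_min lexx.
  have yw : y + 1 <= w by rewrite /y subrK ge_min lexx orbT.
  have py : p y <= F (y + 1) by apply: density_le_F; have := gneg _ yw; lra.
  have Fy := F_nondecreasing yx.
  have Hy : H y <= H w by apply: H_nd; lra.
  have gy : g y <= g w by apply: gneg; lra.
  have D0y : 0 < g1 y + g y ^+ 2 by apply: D0; lra.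
  have : - (H w) <= - g y * p y / (g1 y + g y ^+ 2).
    by move: Hy; rewrite /H; have := F_itv S y; rewrite !mulNr; lra.
  rewrite ler_pdivlMr// => HD.
  have := g1_ge0 y; have := p_gt0 S y => p0 g10.
  have : - H w * (- g w * - g y) <= - g y * p y.
    apply: le_trans HD; rewrite ler_wpM2l//; nra.
  have -> : - H w * (- g w * - g y) = - g y * (- H w * - g w) by ring.
  rewrite ler_pM2l; lra.
have D0w := D0 w (lexx w).
have -> : - g w * p w = (g1 w + g w ^+ 2) * (F w - H w).
  by rewrite /H; field; lra.
by rewrite ler_wpM2l ?(ltW D0w)//; lra.
Qed.

(** The derivative is [((g1 + g^2) F + g p) / p]; its sign is obvious for
    [g >= 0] and is [lower_tail_ge] for [g < 0]. *)
Lemma g_mills_lower_nd : {homo (fun w => g w * M w) : x y / x <= y}.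
Proof.
move=> x y xy.
apply: (@derive_ge0_le _ (fun w => g w * M w)
  (fun u => g1 u * M u + g u * (1 + g u * M u))) => // u _.
  have dM := mills_lower_diff u; have dg := g_diff S u.
  apply: is_derive_eq.
  by rewrite /GRing.scale /=; ring.
have p0 := p_gt0 S u; have F0 := F_gt0 u; have g10 := g1_ge0 u.
have -> : g1 u * M u + g u * (1 + g u * M u) =
    ((g1 u + g u ^+ 2) * F u - - g u * p u) / p u.
  by rewrite /M /mills_lower; field; lra.
apply: divr_ge0; last exact: ltW.
rewrite subr_ge0.
have [gu|gu] := leP 0 (g u); last exact: lower_tail_ge.
by apply: (@le_trans _ _ 0); nra.
Qed.

End stein.

Section stein_upper.
Context {R : realType} {g g1 g2 p F : R -> R} {tau K : R}.
Hypothesis S : stein_setup g g1 g2 p F tau K.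
Let S' := stein_setup_reflect S.
Let N := mills_upper p F.

Lemma F_lt1 w : F w < 1.
Proof. by have := F_gt0 S' (- w); rewrite opprK; lra. Qed.

Lemma upper_tail_le w : g w * (1 - F w) <= p w.
Proof. by have := lower_tail_le S' (- w); rewrite !opprK. Qed.

Lemma mills_upper_diff (w : R) : is_derive w 1 N (g w * N w - 1).
Proof.
have p0 : p w != 0 by rewrite gt_eqF// (p_gt0 S).
have dp := p_diff S w; have dF := F_diff S w.
rewrite /N /mills_upper.
apply: is_derive_eq.
rewrite /GRing.scale /=; field.
exact: p0.
Qed.

Lemma mills_upper_ni : {homo N : x y /~ x <= y}.
Proof.
move=> x y xy; have := @mills_lower_nd _ _ _ _ _ _ _ _ S' (- x) (- y).
by rewrite /mills_lower !opprK lerN2; apply.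
Qed.

Lemma g_mills_upper_nd : {homo (fun w => g w * N w) : x y / x <= y}.
Proof.
move=> x y xy; have := @g_mills_lower_nd _ _ _ _ _ _ _ _ S' (- y) (- x).
by rewrite /mills_lower !opprK !mulNr !lerN2; apply.
Qed.

End stein_upper.

(** * The solution of the Stein equation *)

(** The flag tells closed half-lines from open ones, which reflection
    exchanges. *)
Definition half_line (R : realType) (b : bool) (z w : R) : R :=
  (w < z ?<= if b)%:R.

Lemma half_line_indic (R : realType) (z : R) : half_line true z = \1_`]-oo, z].
Proof.
apply/funext => w; rewrite /half_line indicE /=.
suff -> : (w \in `]-oo, z]%classic) = (w <= z) by [].
by apply/idP/idP; rewrite inE /= in_itv.
Qed.

(** What the probabilistic argument uses about a solution [f] of
    [f' - g f = k].  The equation itself is only present through [sol_incr]: it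
    bounds the first-order Taylor remainder of [f], the derivative being
    [g f + k], by an increment of the nondecreasing function [g f - k]. *)
Record stein_solution (R : realType) (g k f : R -> R) (B : R) : Prop := {
  sol_cont : continuous f;
  sol_ge0 : forall w, 0 <= f w;
  sol_le : forall w, f w <= B;
  sol_le2 : forall w, `|g w * f w| + `|k w| <= 2;
  sol_growth : forall w, `|g w * f w| + `|k w| <= B * (1 + `|g w|);
  sol_incr : forall w w',
    `|f w - f w' - (w - w') * (g w * f w + k w)| <=
    (w - w') * (g w * f w - k w - (g w' * f w' - k w')) }.

Section stein_function.
Context {R : realType} {g g1 g2 p F : R -> R} {tau K : R}.
Hypothesis S : stein_setup g g1 g2 p F tau K.
Variables (b : bool) (z : R).
Let M := mills_lower p F.
Let N := mills_upper p F.
Let f w := Num.min (M w * (1 - F z)) (N w * F z).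
Let h w := g w * f w.
Let k := half_line b z.

Let Fz0 : 0 < F z. Proof. exact: F_gt0 S z. Qed.
Let Fz1 : F z < 1. Proof. exact: F_lt1 S z. Qed.

Let f_z : M z * (1 - F z) = N z * F z.
Proof. by rewrite /M /N /mills_lower /mills_upper mulrAC [RHS]mulrAC [X in X / _]mulrC. Qed.

(** The two branches of the solution are the two arguments of the minimum,
    since [M] increases, [N] decreases, and the branches meet at [z]. *)
Lemma stein_f_left w : w <= z -> f w = M w * (1 - F z).
Proof.
move=> wz; rewrite /f; apply/min_idPl.
have Mwz : M w <= M z by exact: mills_lower_nd S _ _ wz.
have Nzw : N z <= N w by exact: mills_upper_ni S _ _ wz.
apply: (@le_trans _ _ (M z * (1 - F z))).
  by rewrite ler_wpM2r// subr_ge0 ltW.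
by rewrite f_z ler_wpM2r// ltW.
Qed.

Lemma stein_f_right w : z <= w -> f w = N w * F z.
Proof.
move=> wz; rewrite /f; apply/min_idPr.
have Mwz : M z <= M w by exact: mills_lower_nd S _ _ wz.
have Nzw : N w <= N z by exact: mills_upper_ni S _ _ wz.
apply: (@le_trans _ _ (M z * (1 - F z))).
  by rewrite f_z ler_wpM2r// ltW.
by rewrite ler_wpM2r// subr_ge0 ltW.
Qed.

Lemma stein_h_left w : w <= z -> h w = g w * M w * (1 - F z).
Proof. by move=> wz; rewrite /h stein_f_left// mulrA. Qed.

Lemma stein_h_right w : z <= w -> h w = g w * N w * F z.
Proof. by move=> wz; rewrite /h stein_f_right// mulrA. Qed.

Lemma stein_h_nd_left w w' : w' <= w -> w <= z -> h w' <= h w.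
Proof.
move=> ww wz; rewrite !stein_h_left ?(le_trans ww)// ler_wpM2r//.
  by rewrite subr_ge0 ltW.
exact: g_mills_lower_nd S _ _ ww.
Qed.

Lemma stein_h_nd_right w w' : w' <= w -> z <= w' -> h w' <= h w.
Proof.
move=> ww wz; rewrite !stein_h_right ?(le_trans wz)// ler_wpM2r//; first exact: ltW.
exact: g_mills_upper_nd S _ _ ww.
Qed.

Lemma stein_h_nd w w' : w' <= w -> h w' <= h w.
Proof.
move=> ww; have [wz|/ltW zw] := leP w z; first exact: stein_h_nd_left.
have [wz'|/ltW zw'] := leP z w'; first exact: stein_h_nd_right.
exact: le_trans (stein_h_nd_left zw' (lexx z)) (stein_h_nd_right zw (lexx z)).
Qed.

Lemma g_mills_lower_ge w : -1 <= g w * M w.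
Proof.
rewrite /M /mills_lower mulrA ler_pdivlMr ?(p_gt0 S)//.
by have := lower_tail_le S w; lra.
Qed.

Lemma g_mills_upper_le w : g w * N w <= 1.
Proof.
rewrite /N /mills_upper mulrA ler_pdivrMr ?(p_gt0 S)// mul1r.
exact: upper_tail_le S w.
Qed.

Lemma stein_h_ge w : - (1 - F z) <= h w.
Proof.
have h_ge' v : v <= z -> - (1 - F z) <= h v.
  by move=> vz; rewrite stein_h_left// -mulN1r ler_wpM2r ?g_mills_lower_ge// subr_ge0 ltW.
have [wz|/ltW zw] := leP w z; first exact: h_ge'.
exact: le_trans (h_ge' z (lexx z)) (stein_h_nd zw).
Qed.

Lemma stein_h_le w : h w <= F z.
Proof.
have h_le' v : z <= v -> h v <= F z.
  by move=> vz; rewrite stein_h_right// ler_piMl ?g_mills_upper_le// ltW.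
have [wz|/ltW zw] := leP z w; first exact: h_le'.
exact: le_trans (stein_h_nd zw) (h_le' z (lexx z)).
Qed.

Lemma stein_f_increment_left w w' : w' <= w -> w <= z ->
  (w - w') * (h w' + (1 - F z)) <= f w - f w' <= (w - w') * (h w + (1 - F z)).
Proof.
move=> ww wz; rewrite !stein_f_left ?(le_trans ww)//.
have [|c cw ->] := @mean_value _ (fun u => M u * (1 - F z))
  (fun u => (1 + g u * M u) * (1 - F z)) _ _ ww.
  move=> u _; have dM : is_derive u 1 M _ := mills_lower_diff S u.
  apply: is_derive_eq; rewrite /GRing.scale /= /M /N; ring.
have -> : (1 + g c * M c) * (1 - F z) = h c + (1 - F z).
  rewrite stein_h_left; first by ring.
  by case/andP: cw => _ /le_trans; apply.
case/andP: cw => wc cw.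
by rewrite [X in _ <= X <= _]mulrC !ler_wpM2l ?lerD2r ?subr_ge0// stein_h_nd.
Qed.

Lemma stein_f_increment_right w w' : w' <= w -> z <= w' ->
  (w - w') * (h w' - F z) <= f w - f w' <= (w - w') * (h w - F z).
Proof.
move=> ww wz; rewrite !stein_f_right ?(le_trans wz)//.
have [|c cw ->] := @mean_value _ (fun u => N u * F z)
  (fun u => (g u * N u - 1) * F z) _ _ ww.
  move=> u _; have dN : is_derive u 1 N _ := mills_upper_diff S u.
  apply: is_derive_eq; rewrite /GRing.scale /= /M /N; ring.
have -> : (g c * N c - 1) * F z = h c - F z.
  rewrite stein_h_right; first by ring.
  by case/andP: cw => /(le_trans wz).
case/andP: cw => wc cw.
by rewrite [X in _ <= X <= _]mulrC !ler_wpM2l ?lerD2r ?subr_ge0// stein_h_nd.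
Qed.

Lemma half_line_left w : w < z -> k w = 1.
Proof. by move=> wz; rewrite /k /half_line lteifS. Qed.

Lemma half_line_right w : z < w -> k w = 0.
Proof.
move=> wz; rewrite /k /half_line; suff -> : (w < z ?<= if b) = false by [].
by apply/negbTE; rewrite -lteifNE lteifS.
Qed.

Lemma half_line_itv w : 0 <= k w <= 1.
Proof. by rewrite /k /half_line; case: (_ < _ ?<= if _) => /=; lra. Qed.

(** On an interval around [z] the mean value theorem is applied on each side of
    [z] separately, as [f] has a corner there. *)
Lemma stein_f_increment w w' : w' <= w ->
  (w - w') * (h w' + (k w - F z)) <= f w - f w' <=
  (w - w') * (h w + (k w' - F z)).
Proof.
rewrite le_eqVlt => /predU1P[->|ww]; first by rewrite !subrr !mul0r lexx.
have kw := half_line_itv w; have kw' := half_line_itv w'.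
have [wz|zw] := leP w z.
  have := stein_f_increment_left (ltW ww) wz.
  by rewrite (half_line_left (lt_le_trans ww wz)) => /andP[H1 H2]; apply/andP; split; nra.
have [wz'|zw'] := leP z w'.
  have := stein_f_increment_right (ltW ww) wz'.
  by rewrite (half_line_right (le_lt_trans wz' ww)) => /andP[H1 H2]; apply/andP; split; nra.
have := stein_f_increment_right (ltW zw) (lexx z).
have := stein_f_increment_left (ltW zw') (lexx z).
rewrite (half_line_left zw') (half_line_right zw) => /andP[H1 H2] /andP[H3 H4].
have := stein_h_nd (ltW zw'); have := stein_h_nd (ltW zw) => H5 H6.
by apply/andP; split; nra.
Qed.

(** The derivative of [f] is the nondecreasing [h] plus the nonincreasing
    [k - F z].  Taking the extreme values of both on the interval between [w']
    and [w] bounds the remainder by an increment of [h - k]. *)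
Lemma stein_f_increment_bound w w' :
    `|f w - f w' - (w - w') * (h w + (k w - F z))| <=
    (w - w') * (h w - (k w - F z) - (h w' - (k w' - F z))).
Proof.
have k_ni v v' : v' <= v -> k v <= k v'.
  move=> vv; have := half_line_itv v; have := half_line_itv v'.
  have [v'z|zv'] := ltP v' z; first by rewrite (half_line_left v'z); lra.
  move: vv; rewrite le_eqVlt => /predU1P[->//|vv].
  by rewrite (half_line_right (le_lt_trans zv' vv)); lra.
have [ww|/ltW ww] := leP w' w.
  have /andP[H1 H2] := stein_f_increment ww; have := stein_h_nd ww; have := k_ni _ _ ww.
  by rewrite ler_norml => H3 H4; apply/andP; split; nra.
have /andP[H1 H2] := stein_f_increment ww; have := stein_h_nd ww; have := k_ni _ _ ww.
by rewrite ler_norml => H3 H4; apply/andP; split; nra.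
Qed.

Lemma stein_f_ge0 w : 0 <= f w.
Proof.
rewrite /f le_min; apply/andP; split; apply: mulr_ge0 => //.
- by apply: divr_ge0; apply/ltW; [exact: F_gt0 S w|exact: p_gt0 S w].
- by rewrite subr_ge0 ltW.
- apply: divr_ge0; apply/ltW; last exact: p_gt0 S w.
  by rewrite subr_gt0; exact: F_lt1 S w.
- exact: ltW.
Qed.

Lemma stein_f_le w : f w <= N z * F z.
Proof.
rewrite /f ge_min; have [wz|/ltW zw] := leP w z.
  apply/orP; left; rewrite -f_z; apply: ler_wpM2r; first by rewrite subr_ge0 ltW.
  exact: mills_lower_nd S _ _ wz.
apply/orP; right; apply: ler_wpM2r; first exact: ltW.
exact: mills_upper_ni S _ _ zw.
Qed.

Lemma stein_f_continuous : continuous f.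
Proof.
move=> w; apply: (@continuous_min _ _ (fun w => M w * (1 - F z)) (fun w => N w * F z)).
  apply: continuousM; last exact: cst_continuous.
  have [dM _] := mills_lower_diff S w.
  exact/differentiable_continuous/derivable1_diffP.
apply: continuousM; last exact: cst_continuous.
have [dM _] := mills_upper_diff S w.
exact/differentiable_continuous/derivable1_diffP.
Qed.

Lemma g_ge0 x : 0 < x -> 0 <= g x.
Proof. by move=> x0; have := g_sign S x; rewrite pmulr_rge0. Qed.

Lemma p_nonincreasing x y : 0 < x -> x <= y -> p y <= p x.
Proof.
move=> x0 xy; rewrite -lerN2.
apply: (@derive_ge0_le _ (fun u => - p u) (fun u => g u * p u)) => // u /andP[xu uy].
  by have dp := p_diff S u; apply: is_derive_eq; rewrite opprK.
by rewrite mulr_ge0 ?(ltW (p_gt0 S u))// g_ge0// (lt_le_trans x0).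
Qed.

Let near_weight := 1 + `|g 0| + `|g 1|.

Lemma near_weight_ge : 0 <= z -> z <= 1 -> 1 + `|g z| <= near_weight.
Proof.
move=> z0 z1; have := g_nd S z0; have := g_nd S z1; rewrite /near_weight.
by case: (ger0P (g z)); case: (ger0P (g 0)); case: (ger0P (g 1)); lra.
Qed.

Lemma stein_f_peak_weight : 1 <= z -> f z * (1 + g z) <= N 0 + 1.
Proof.
move=> z1; have gz0 : 0 <= g z by apply: g_ge0; lra.
have N0 : N z <= N 0 by apply: (mills_upper_ni S); lra.
rewrite (@le_trans _ _ (N z * (1 + g z)))//.
  apply: ler_wpM2r; first lra.
  rewrite stein_f_right// ler_piMr ?(ltW Fz1)// divr_ge0 ?(ltW (p_gt0 S z))//.
  by rewrite subr_ge0 ltW.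
by have := g_mills_upper_le z; lra.
Qed.

Lemma upper_tail_weight : 1 <= z -> (1 - F z) * (1 + g z) <= 1 + p 1.
Proof.
move=> z1; have := upper_tail_le S z; have := p_nonincreasing ltr01 z1; have := Fz0; lra.
Qed.

(** The heart of the non-uniform estimate.  Between [t := tau * z] and [z] the
    slope of [p] is at least [g t * p z] in absolute value, so [p] drops by a
    factor [1 + (1 - tau) * g t], the distance being at least [1 - tau]; and [g t] is comparable to [g z]. *)
Lemma stein_h_tau_weight : 1 <= z -> h (tau * z) * (1 + g z) <= 1 + K / (1 - tau).
Proof.
move=> z1; set t := tau * z.
have /andP[t0 t1] := tau_itv S; have K0 := K_gt0 S.
have tz : t < z by rewrite /t; nra.
have t_gt0 : 0 < t by rewrite /t; nra.
have gt0 := g_ge0 t_gt0; have gz0 : 0 <= g z by apply: g_ge0; lra.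
have gtz : g t <= g z by apply: (g_nd S); exact: ltW.
have gzK : g z <= K * g t.
  by have := g_tau S z; rewrite !ger0_norm.
have pz := p_gt0 S z; have pt := p_gt0 S t.
have Ft1 := F_lt1 S t; have Ft0 := F_gt0 S t.
have drop : p z * (1 + (1 - tau) * g t) <= p t.
  have [|c /andP[tc cz] E] := @mean_value _ p (fun u => - (g u * p u)) _ _ (ltW tz).
    by move=> u _; exact: p_diff S u.
  have pc : p z <= p c by apply: p_nonincreasing => //; lra.
  have gc : g t <= g c by exact: (g_nd S).
  have gp : g t * p z <= g c * p c by apply: ler_pM => //; exact: ltW.
  have zt : (1 - tau) <= z - t by rewrite /t; nra.
  have gp0 : 0 <= g t * p z by rewrite mulr_ge0// ltW.
  have : (1 - tau) * (g t * p z) <= (z - t) * (g c * p c).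
    by apply: ler_pM => //; lra.
  lra.
have hp : h t * p t <= p z.
  rewrite (stein_h_left (ltW tz)) /M /mills_lower.
  have -> : g t * (F t / p t) * (1 - F z) * p t = g t * (1 - F z) * F t.
    by field; lra.
  apply: (@le_trans _ _ (g t * (1 - F z))).
    by rewrite ler_piMr ?(ltW Ft1)// mulr_ge0// subr_ge0 ltW.
  by have := upper_tail_le S z; have := Fz1; nra.
have ht0 : 0 <= h t by rewrite mulr_ge0// stein_f_ge0.
have h1 : h t * (1 + (1 - tau) * g t) <= 1.
  rewrite -(ler_pM2r pz) mul1r (le_trans _ hp)// -mulrA ler_wpM2l//.
  by rewrite mulrC.
have w1 : 1 + g z <= (1 + K / (1 - tau)) * (1 + (1 - tau) * g t).
  have -> : (1 + K / (1 - tau)) * (1 + (1 - tau) * g t) =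
    1 + K * g t + (1 - tau) * g t + K / (1 - tau) by field; lra.
  have : 0 <= K / (1 - tau) by rewrite divr_ge0; lra.
  nra.
have KK : 0 <= 1 + K / (1 - tau).
  have : 0 <= K / (1 - tau) by rewrite divr_ge0; lra.
  lra.
apply: le_trans (ler_wpM2l ht0 w1) _.
by rewrite mulrCA ler_piMr.
Qed.

(** Sum of the constants of all regimes: [z <= 1], where [1 + |g z|] is
    bounded; [z >= 1] and [w] beyond [tau * z]; [z >= 1] and [w <= tau * z]. *)
Definition stein_constant := 2 * near_weight + near_weight * N 0 + (N 0 + 1) +
  2 * (1 + K) + 2 * (1 + p 1) + (1 + K / (1 - tau)).

Hypothesis z0 : 0 <= z.

Lemma near_weight_ge1 : 1 <= near_weight.
Proof. by rewrite /near_weight -addrA lerDl addr_ge0. Qed.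

Lemma N0_gt0 : 0 < N 0.
Proof. by apply: divr_gt0; [rewrite subr_gt0 (F_lt1 S)|exact: p_gt0 S _]. Qed.

Lemma stein_h_half_line_le2 w : `|h w| + `|k w - F z| <= 2.
Proof.
have h1 : `|h w| <= 1.
  by rewrite ler_norml; have := stein_h_ge w; have := stein_h_le w; have := Fz0; have := Fz1; lra.
have k1 : `|k w - F z| <= 1.
  by rewrite ler_norml; have := half_line_itv w; have := Fz0; have := Fz1; lra.
lra.
Qed.

Lemma K_tau_ge0 : 0 <= K / (1 - tau).
Proof. by have := tau_itv S; have := K_gt0 S => ? ?; rewrite divr_ge0; lra. Qed.

Lemma stein_f_weight w : f w * (1 + `|g z|) <= stein_constant.
Proof.
have fN : f w <= N z * F z := stein_f_le w.
have NF0 : N z <= N 0 by exact: (mills_upper_ni S).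
have := near_weight_ge1; have := N0_gt0; have := K_tau_ge0; have := K_gt0 S.
have := p_gt0 S 1 => p1 K0 Kt0 N0 nw.
have fN0 := mulr_ge0 (le_trans ler01 nw) (ltW N0).
have [z1|/ltW z1] := leP 1 z.
  have gz0 : 0 <= g z by apply: g_ge0; lra.
  rewrite (ger0_norm gz0).
  have : f w * (1 + g z) <= f z * (1 + g z).
    by rewrite (stein_f_right (lexx z)); apply: ler_wpM2r => //; lra.
  have := stein_f_peak_weight z1; rewrite /stein_constant; lra.
have : f w * (1 + `|g z|) <= N 0 * near_weight.
  apply: ler_pM (near_weight_ge z0 z1) => //; first exact: stein_f_ge0.
  apply: (le_trans fN); apply: le_trans NF0; rewrite ler_piMr ?(ltW Fz1)//.
  by rewrite divr_ge0 ?(ltW (p_gt0 S z))// subr_ge0 ltW.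
rewrite /stein_constant; lra.
Qed.

(** Small [z] is trivial.  For [z >= 1], either [w > tau * z] and the weight
    [1 + g z] is at most [(1 + K) (1 + g w)], or [w <= tau * z] and the
    monotone [h] is controlled by its value at [tau * z]. *)
Lemma stein_h_growth w :
  (`|h w| + `|k w - F z|) * (1 + `|g z|) <= stein_constant * (1 + `|g w|).
Proof.
have hk2 := stein_h_half_line_le2 w.
have nw := near_weight_ge1; have N0 := N0_gt0.
have Kt0 := K_tau_ge0; have K0 := K_gt0 S.
have p1 := p_gt0 S 1.
have fN0 := mulr_ge0 (le_trans ler01 nw) (ltW N0).
have hk0 : 0 <= `|h w| + `|k w - F z| by rewrite addr_ge0.
have C0 : 0 <= stein_constant by rewrite /stein_constant; lra.
have gw0 : 0 <= `|g w| by [].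
have red : stein_constant <= stein_constant * (1 + `|g w|).
  by rewrite ler_peMr//; lra.
have [z1|/ltW z1] := leP 1 z; last first.
  apply: le_trans red; apply: (@le_trans _ _ (2 * near_weight)).
    by apply: ler_pM => //; exact: near_weight_ge.
  by rewrite /stein_constant; lra.
have gz0 : 0 <= g z by apply: g_ge0; lra.
rewrite (ger0_norm gz0).
have /andP[t0 t1] := tau_itv S.
have tz : tau * z < z by nra.
have t_gt0 : 0 < tau * z by nra.
have gt0 := g_ge0 t_gt0.
have [wt|/ltW tw] := leP w (tau * z); last first.
  have gtw : g (tau * z) <= g w by exact: (g_nd S).
  rewrite (ger0_norm (le_trans gt0 gtw)).
  have gzK := g_tau S z; rewrite !ger0_norm// in gzK.
  apply: (@le_trans _ _ (2 * (1 + K) * (1 + g w))).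
    by rewrite -mulrA; apply: ler_pM => //; nra.
  by rewrite ler_wpM2r//; rewrite /stein_constant; lra.
apply: le_trans red.
rewrite half_line_left ?(le_lt_trans wt)//.
have tw := upper_tail_weight z1; have ht := stein_h_tau_weight z1.
have hw : h w <= h (tau * z) by exact: stein_h_nd.
have h0 : 0 <= h (tau * z) by rewrite mulr_ge0// stein_f_ge0.
have hw1 := stein_h_ge w.
have hn : `|h w| <= h (tau * z) + (1 - F z).
  by rewrite ler_norml; have := Fz1; lra.
rewrite (ger0_norm (_ : 0 <= 1 - F z)) ?subr_ge0 ?(ltW Fz1)//.
apply: (@le_trans _ _ ((h (tau * z) + (1 - F z) + (1 - F z)) * (1 + g z))).
  by rewrite ler_wpM2r//; lra.
rewrite /stein_constant; lra.
Qed.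

Lemma stein_solution_ge0 :
  stein_solution g (fun w => k w - F z) f (stein_constant / (1 + `|g z|)).
Proof.
have gz0 : 0 < 1 + `|g z| by rewrite ltr_pwDl.
split.
- exact: stein_f_continuous.
- exact: stein_f_ge0.
- by move=> w; rewrite ler_pdivlMr// stein_f_weight.
- exact: stein_h_half_line_le2.
- by move=> w; rewrite mulrAC ler_pdivlMr// stein_h_growth.
- exact: stein_f_increment_bound.
Qed.

End stein_function.

Lemma stein_solution_le (R : realType) (g k f : R -> R) (B B' : R) :
  B <= B' -> stein_solution g k f B -> stein_solution g k f B'.
Proof.
move=> BB [cf f0 fB fk2 fk fi]; split=> // w; first exact: le_trans BB.
by rewrite (le_trans (fk w))// ler_wpM2r.
Qed.

(** Under [x |-> - x] both [g f] and [k] change sign, and the increments of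
    [f] and [g f - k] are transported accordingly. *)
Lemma stein_solution_reflect (R : realType) (g k f : R -> R) (B : R) :
  stein_solution (fun x => - g (- x)) k f B ->
  stein_solution g (fun w => - k (- w)) (fun w => f (- w)) B.
Proof.
case=> cf f0 fB fk2 fk fi; split.
- by move=> w; apply: continuous_comp; [exact: opp_continuous|exact: cf].
- by move=> w; exact: f0.
- by move=> w; exact: fB.
- by move=> w; rewrite normrN; have := fk2 (- w); rewrite opprK mulNr normrN.
- move=> w; rewrite normrN; have := fk (- w).
  by rewrite opprK mulNr !normrN.
- move=> w w'; have := fi (- w) (- w'); rewrite !opprK.
  congr (`|_| <= _); ring.
Qed.

Lemma half_line_opp (R : realType) (b : bool) (z w : R) :
  half_line (~~ b) (- z) (- w) = 1 - half_line b z w.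
Proof.
rewrite /half_line -[RHS]opprB.
have -> : (- w < - z ?<= if ~~ b) = ~~ (w < z ?<= if b).
  by rewrite -lteifNE; case: (b); rewrite /= ?lerN2 ?ltrN2.
by case: (_ < _ ?<= if _) => /=; rewrite ?subrr ?oppr0// sub0r opprK.
Qed.

Lemma stein_solution_exists (R : realType) (g g1 g2 p F : R -> R) (tau K : R) :
  stein_setup g g1 g2 p F tau K ->
  exists2 C : R, 0 < C & forall z, exists f,
    stein_solution g (fun w => half_line true z w - F z) f (C / (1 + `|g z|)).
Proof.
move=> S; have S' := stein_setup_reflect S.
pose C1 := stein_constant (g := g) (p := p) (F := F) (tau := tau) (K := K).
pose C2 := stein_constant (g := fun x => - g (- x)) (p := fun x => p (- x))
  (F := fun x => 1 - F (- x)) (tau := tau) (K := K).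
exists (`|C1| + `|C2| + 1); first by rewrite ltr_wpDl.
move=> z.
have gz0 : 0 < (1 + `|g z|)^-1 by rewrite invr_gt0 ltr_pwDl.
have [z0|/ltW z0] := leP 0 z.
  eexists; apply: stein_solution_le; last exact: (stein_solution_ge0 S true z0).
  rewrite ler_pM2r//; have := ler_norm C1; rewrite /C1.
  by have := normr_ge0 C2; lra.
have z0' : 0 <= - z by rewrite oppr_ge0.
have := stein_solution_ge0 S' false z0'.
rewrite !opprK normrN => /stein_solution_reflect sol.
eexists; apply: (@stein_solution_le _ _ _ _ (C2 / (1 + `|g z|))).
  rewrite ler_pM2r//; have := ler_norm C2.
  by have := normr_ge0 C1; lra.
have -> : (fun w => half_line true z w - F z) =
    (fun w => - (half_line false (- z) (- w) - (1 - F z))).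
  by apply/funext => w; rewrite (half_line_opp true); ring.
exact: sol.
Qed.

(** * The density and its distribution function *)
Section density_setup.
Context {R : realType}.
Notation mu := (@lebesgue_measure R).

Lemma continuous_integrable_itv (g : R -> R) (a b : R) : continuous g ->
  mu.-integrable `[a, b] (EFin \o g).
Proof.
move=> cg; apply: continuous_compact_integrable; first exact: segment_compact.
exact: continuous_subspaceT.
Qed.

(** Near [x] the two-sided definition of the potential is the one-sided
    primitive from a point [a] to the left of both [x] and [0], up to a
    constant. *)
Lemma potential_diff (g : R -> R) (x : R) : continuous g ->
  is_derive x 1 (potential g) (g x).
Proof.
move=> cg.
pose a := Num.min x 0 - 1.
have ax : a < x by rewrite /a ltrBlDr gt_min ltrDl ltr01.
have a0 : a < 0 by rewrite /a subr_lt0 gt_min ltr01 orbT.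
have int a' b' := @continuous_integrable_itv g a' b' cg.
pose Ga y := \int[mu]_(t in `[a, y]) g t.
have GaE y : a < y -> Ga y - Ga 0 = potential g y.
  move=> ay; rewrite /potential /Ga; case: ifPn => [y0|].
    rewrite Rintegral_itvB ?bnd_simp// ?(ltW a0)//.
    rewrite Rintegral_itv_obnd_cbnd//; apply: (integrableS _ _ _ (int 0 y)) => //.
    exact: subset_itv_oc_cc.
  rewrite -ltNge => y0; rewrite -opprB Rintegral_itvB ?bnd_simp// ?ltW//.
  rewrite Rintegral_itv_obnd_cbnd//; apply: (integrableS _ _ _ (int y 0)) => //.
  exact: subset_itv_oc_cc.
apply: (@near_eq_is_derive _ _ _ (fun y => Ga y - Ga 0)).
  near=> y; apply: GaE; near: y.
  exact: lt_nbhsr.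
have [||||dG GE] := @continuous_FTC1_closed R g a x (x + 1).
- by rewrite ltrDl.
- exact: int.
- exact: ax.
- exact: cg.
have dGa : is_derive x 1 Ga (g x).
  by rewrite -GE derive1E; apply: DeriveDef.
by apply: is_derive_eq; rewrite subr0.
Unshelve. all: by end_near. Qed.

Section primitive.
Variable p : R -> R.
Hypothesis p0 : forall x, 0 < p x.
Hypothesis cp : continuous p.
Hypothesis p1 : (\int[mu]_x (p x)%:E = 1)%E.
Let F z := \int[mu]_(x in `]-oo, z]) p x.

Let mp : measurable_fun setT (EFin \o p).
Proof. by apply/measurable_EFinP; exact: continuous_measurable_fun. Qed.

Let ip : mu.-integrable setT (EFin \o p).
Proof.
apply/integrableP; split => //.
under eq_integral => x _ do rewrite /= ger0_norm ?(ltW (p0 x))//.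
by rewrite p1 ltry.
Qed.

Let FE z : (F z)%:E = (\int[mu]_(x in `]-oo, z]) (p x)%:E)%E.
Proof.
rewrite /F /Rintegral fineK//; apply: integrable_fin_num => //.
exact: integrableS ip.
Qed.

Lemma primitive_diff (z : R) : is_derive z 1 F (p z).
Proof.
have [||||dG GE] := @continuous_FTC1 R p (BInfty _ true) z (z + 1).
- by rewrite ltrDl.
- exact: integrableS ip.
- by rewrite ltNyr.
- exact: cp.
by rewrite -GE derive1E; apply: DeriveDef.
Qed.

Lemma primitive_itv z : 0 <= F z <= 1.
Proof.
apply/andP; split; first by apply: Rintegral_ge0 => x _; exact: ltW.
rewrite -lee_fin FE -p1; apply: ge0_subset_integral => //.
by move=> x _; rewrite lee_fin ltW.
Qed.

Lemma exhausting_mass (E : (set R)^nat) (e : R) : nondecreasing_seq E ->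
  (forall n, measurable (E n)) -> \bigcup_n E n = setT -> 0 < e ->
  exists n, 1 - e < \int[mu]_(x in E n) p x.
Proof.
move=> ndE mE ET e0; apply: contrapT => /forallNP small.
have cvE := @ge0_nondecreasing_set_cvg_integral _ (measurableTypeR R) _ E (EFin \o p) mu ndE mE
  (fun n => measurable_funTS mp) (fun n x _ => ltW (p0 x)).
rewrite ET /= p1 in cvE.
have : ((1 : R)%:E <= (1 - e)%:E)%E.
  apply: (cvge_le _ cvE); near=> n.
  move/negP: (small n); rewrite -leNgt -lee_fin /Rintegral fineK//.
  apply: integrable_fin_num; first exact: mE.
  exact: (@integrableS _ (measurableTypeR R) R mu setT (E n) _ measurableT (mE n) _ ip).
by rewrite lee_fin lerBrDl; lra.
Unshelve. all: by end_near. Qed.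

Lemma primitive_sup e : 0 < e -> exists x, 1 - F x < e.
Proof.
move=> e0.
have [||||n] := @exhausting_mass (fun i => `]-oo, i%:R]%classic) e => //.
- move=> i j ij; rewrite subsetEset; apply: subset_itvl.
  by rewrite bnd_simp ler_nat.
- apply/seteqP; split => // x _; exists (Num.truncn `|x|).+1 => //=.
  rewrite in_itv/=; apply: le_trans (ler_norm x) (ltW _).
  exact: truncnS_gt.
- by move=> Fn; exists n%:R; rewrite /F; lra.
Qed.

Lemma primitive_inf e : 0 < e -> exists x, F x < e.
Proof.
move=> e0.
have [||||n] := @exhausting_mass (fun i => `]- i%:R, +oo[%classic) e => //.
- move=> i j ij; rewrite subsetEset; apply: subset_itvr.
  by rewrite bnd_simp lerN2 ler_nat.
- apply/seteqP; split => // x _; exists (Num.truncn `|x|).+1 => //=.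
  rewrite in_itv/= andbT ltrNl; apply: le_lt_trans (ler_norm _) _.
  by rewrite normrN truncnS_gt.
- rewrite -(@Rintegral_itvB R p (BInfty _ true) (BInfty _ false))//; last first.
    by rewrite set_itvE.
  rewrite set_itvE /Rintegral p1 /= => Fn; exists (- n%:R); rewrite /F /Rintegral.
  by move: Fn; lra.
Qed.

End primitive.

Lemma stein_setup_density (g : R -> R) (c1 tau : R) :
  class_C2 g -> normalizing g c1 -> condA1 g -> condA2 g -> condA4 g tau ->
  exists K, stein_setup g (derive1 g) (derive1n 2 g) (density g c1)
    (distr_fun g c1) tau K.
Proof.
move=> [dg dg1 cg2] [c10 p1] [gnd gs] [cg1 gc] [t01 [K K0 gt]].
have cg : continuous g.
  by move=> x; apply/differentiable_continuous/derivable1_diffP/dg.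
have dp (x : R) : is_derive x 1 (density g c1) (- (g x * density g c1 x)).
  have dG := @potential_diff g x cg.
  rewrite /density; apply: is_derive_eq.
  rewrite /GRing.scale /=; ring.
have p0 x : 0 < density g c1 x by rewrite mulr_gt0// expR_gt0.
have cp : continuous (density g c1).
  move=> x; apply/differentiable_continuous/derivable1_diffP.
  by have [] := dp x.
exists K; split.
- exact: gnd.
- exact: gs.
- by move=> x; rewrite derive1E; apply: DeriveDef; first exact: dg.
- by move=> x; rewrite /= derive1E; apply: DeriveDef; first exact: dg1.
- exact: gc.
- exact: t01.
- exact: K0.
- exact: gt.
- exact: p0.
- exact: dp.
- exact: primitive_diff p0 cp p1.
- exact: primitive_itv p0 cp p1.
- exact: primitive_inf p0 cp p1.
- exact: primitive_sup p0 cp p1.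
Qed.

End density_setup.

(** * Means of real random variables *)
Section mean.
Context d (T : measurableType d) (R : realType) (P : probability T R).
Implicit Types X Y Z : T -> R.

(** Real-valued integrability and expectation, so that the identities between
    expectations can be handled by ring arithmetic. *)
Definition rv_integrable Y := P.-integrable setT (EFin \o Y).
Definition mean Y := \int[P]_w Y w.

Lemma rv_integrable_measurable Y : rv_integrable Y -> measurable_fun setT Y.
Proof. by move=> /measurable_int/measurable_EFinP. Qed.

Lemma rv_integrable_le X Y : measurable_fun setT X ->
  (forall w, `|X w| <= Y w) -> rv_integrable Y -> rv_integrable X.
Proof.
move=> mX XY; apply: le_integrable => //; first exact/measurable_EFinP.
by move=> w _; rewrite /= lee_fin (le_trans (XY w))// ler_norm.
Qed.

Lemma rv_integrable_cst (c : R) : rv_integrable (cst c).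
Proof. exact: finite_measure_integrable_cst. Qed.

Lemma rv_integrableD X Y : rv_integrable X -> rv_integrable Y -> rv_integrable (fun w => X w + Y w).
Proof. by move=> iX iY; exact: (integrableD measurableT iX iY). Qed.

Lemma rv_integrableZ (c : R) X : rv_integrable X -> rv_integrable (fun w => c * X w).
Proof. by move=> iX; exact: (integrableZl measurableT c iX). Qed.

Lemma rv_integrableB X Y : rv_integrable X -> rv_integrable Y -> rv_integrable (fun w => X w - Y w).
Proof. by move=> iX iY; exact: (integrableB measurableT iX iY). Qed.

Lemma rv_integrable_norm X : rv_integrable X -> rv_integrable (fun w => `|X w|).
Proof. by move=> iX; exact: (integrable_norm iX). Qed.

Lemma rv_integrable_bounded_mul (c : R) X Y : measurable_fun setT X ->
  (forall w, `|X w| <= c) -> rv_integrable Y -> rv_integrable (fun w => X w * Y w).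
Proof.
move=> mX Xc iY; apply: (@rv_integrable_le _ (fun w => c * `|Y w|)).
- by apply: measurable_funM => //; exact: rv_integrable_measurable.
- by move=> w; rewrite normrM ler_wpM2r.
- exact/rv_integrableZ/rv_integrable_norm.
Qed.

Lemma rv_integrable_mul X Y : measurable_fun setT X -> measurable_fun setT Y ->
  rv_integrable (fun w => X w ^+ 2) -> rv_integrable (fun w => Y w ^+ 2) ->
  rv_integrable (fun w => X w * Y w).
Proof.
move=> mX mY iX iY; apply: rv_integrable_le (rv_integrableD iX iY).
  exact: measurable_funM.
move=> w; rewrite normrM -[X w ^+ 2]real_normK ?num_real//.
rewrite -[Y w ^+ 2]real_normK ?num_real//.
by have := normr_ge0 (X w); have := normr_ge0 (Y w); nra.
Qed.

Lemma rv_integrable_sqr X : measurable_fun setT X ->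
  rv_integrable (fun w => X w ^+ 2) -> rv_integrable X.
Proof.
move=> mX iX; apply: rv_integrable_le (rv_integrableD iX (rv_integrable_cst 1)) => // w /=.
by rewrite -real_normK ?num_real//; have := normr_ge0 (X w); nra.
Qed.

Lemma eq_mean X Y : X =1 Y -> mean X = mean Y.
Proof. by move=> XY; apply: eq_Rintegral => w _; exact: XY. Qed.

Lemma meanD X Y : rv_integrable X -> rv_integrable Y ->
  mean (fun w => X w + Y w) = mean X + mean Y.
Proof. by move=> iX iY; exact: RintegralD. Qed.

Lemma meanB X Y : rv_integrable X -> rv_integrable Y ->
  mean (fun w => X w - Y w) = mean X - mean Y.
Proof. by move=> iX iY; exact: RintegralB. Qed.

Lemma meanZ (c : R) X : rv_integrable X -> mean (fun w => c * X w) = c * mean X.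
Proof. by move=> iX; exact: RintegralZl. Qed.

Lemma mean_cst (c : R) : mean (cst c) = c.
Proof. by rewrite /mean Rintegral_cst//; have /= -> := @probability_setT _ _ _ P; rewrite mulr1. Qed.

Lemma le_mean X Y : rv_integrable X -> rv_integrable Y -> (forall w, X w <= Y w) ->
  mean X <= mean Y.
Proof. by move=> iX iY XY; apply: le_Rintegral. Qed.

Lemma mean_ge0 X : (forall w, 0 <= X w) -> 0 <= mean X.
Proof. by move=> X0; apply: Rintegral_ge0. Qed.

Lemma le_norm_mean X : rv_integrable X -> `|mean X| <= mean (fun w => `|X w|).
Proof. by move=> iX; apply: le_normr_Rintegral. Qed.

Lemma EFin_mean X : rv_integrable X -> ((mean X)%:E = \int[P]_w (X w)%:E)%E.
Proof. by move=> iX; rewrite /mean /Rintegral fineK//; apply: integrable_fin_num. Qed.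

Lemma ae_eq_mean X Y : measurable_fun setT X -> measurable_fun setT Y ->
  {ae P, forall w, X w = Y w} -> mean X = mean Y.
Proof.
move=> mX mY XY; rewrite /mean /Rintegral; congr fine.
apply: ae_eq_integral => //; try exact/measurable_EFinP.
by apply: filterS XY => w /= -> _.
Qed.

(** Replacing [Y] by [max X Y], which is almost everywhere equal to it, reduces
    to a pointwise inequality. *)
Lemma ae_le_mean X Y : rv_integrable X -> rv_integrable Y ->
  {ae P, forall w, X w <= Y w} -> mean X <= mean Y.
Proof.
move=> iX iY XY.
have mX := rv_integrable_measurable iX; have mY := rv_integrable_measurable iY.
have -> : mean Y = mean (fun w => Num.max (X w) (Y w)).
  apply: ae_eq_mean => //; first exact: measurable_maxr.
  by apply: filterS XY => w /= /max_idPr.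
apply: le_mean => // [|w]; last by rewrite le_max lexx.
apply: rv_integrable_le (rv_integrableD (rv_integrable_norm iX) (rv_integrable_norm iY)).
  exact: measurable_maxr.
move=> w; have := normr_ge0 (X w); have := normr_ge0 (Y w).
by case: (leP (X w) (Y w)); lra.
Qed.

(** Discriminant argument: the mean of [(t X - Y)^2] is nonnegative for all
    [t], in particular for [t := q / A^2].  The bound [A] on the L2 norm of [X]
    is positive, so no degenerate case arises. *)
Lemma cauchy_schwarz (A : R) X Y : measurable_fun setT X -> measurable_fun setT Y ->
  rv_integrable (fun w => X w ^+ 2) -> rv_integrable (fun w => Y w ^+ 2) ->
  0 < A -> mean (fun w => X w ^+ 2) <= A ^+ 2 ->
  `|mean (fun w => X w * Y w)| <= A * Num.sqrt (mean (fun w => Y w ^+ 2)).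
Proof.
move=> mX mY iX iY A0 XA; have iXY := rv_integrable_mul mX mY iX iY.
set q := mean _; set s := mean (fun w => Y w ^+ 2).
have s0 : 0 <= s by apply: mean_ge0 => w; exact: sqr_ge0.
have disc t : 0 <= t ^+ 2 * mean (fun w => X w ^+ 2) - 2 * t * q + s.
  rewrite -!meanZ// -meanB//; [|exact: rv_integrableZ..].
  rewrite -meanD//; last by apply: rv_integrableB; exact: rv_integrableZ.
  apply: mean_ge0 => w.
  have -> : t ^+ 2 * X w ^+ 2 - 2 * t * (X w * Y w) + Y w ^+ 2 =
    (t * X w - Y w) ^+ 2 by ring.
  exact: sqr_ge0.
have A2 : 0 < A ^+ 2 by rewrite exprn_gt0.
have qs : q ^+ 2 <= A ^+ 2 * s.
  have := disc (q / A ^+ 2).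
  have -> : 2 * (q / A ^+ 2) * q = 2 * (q ^+ 2 / A ^+ 2) by ring.
  have : (q / A ^+ 2) ^+ 2 * mean (fun w => X w ^+ 2) <= q ^+ 2 / A ^+ 2.
    have -> : q ^+ 2 / A ^+ 2 = (q / A ^+ 2) ^+ 2 * A ^+ 2 by field; lra.
    by rewrite ler_wpM2l// sqr_ge0.
  move=> H1 H2; have : q ^+ 2 / A ^+ 2 <= s by lra.
  by rewrite ler_pdivrMr// mulrC.
rewrite -(ler_pXn2r (_ : (0 < 2)%N))// ?nnegrE ?mulr_ge0 ?sqrtr_ge0 ?(ltW A0)//.
by rewrite exprMn sqr_sqrtr// real_normK ?num_real.
Qed.

End mean.

(** * Exchangeable pairs and conditional expectations *)
Section exchange.
Context d (T : measurableType d) (R : realType) (P : probability T R).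
Variables W W' : T -> R.
Hypotheses (mW : measurable_fun setT W) (mW' : measurable_fun setT W').
Hypothesis exW : exchangeable P W W'.

Let mWW : measurable_fun setT (fun w => (W w, W' w)).
Proof. exact: measurable_fun_pair. Qed.

Let mWW' : measurable_fun setT (fun w => (W' w, W w)).
Proof. exact: measurable_fun_pair. Qed.

Lemma exchange_integral (q : R * R -> \bar R) : measurable_fun setT q ->
  (forall x, 0 <= q x)%E ->
  (\int[P]_w q (W w, W' w) = \int[P]_w q (W' w, W w))%E.
Proof.
move=> mq q0.
have := @ge0_integral_pushforward _ _ _ _ _ _ mWW P setT q measurableT mq (fun x _ => q0 x).
have := @ge0_integral_pushforward _ _ _ _ _ _ mWW' P setT q measurableT mq (fun x _ => q0 x).
rewrite !preimage_setT => <- <-.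
apply: eq_measure_integral => A mA _; exact: exW.
Qed.

Lemma exchange_mean (q : R * R -> R) : measurable_fun setT q ->
  mean P (fun w => q (W w, W' w)) = mean P (fun w => q (W' w, W w)).
Proof.
move=> mq; rewrite /mean /Rintegral; congr fine.
rewrite integralE [RHS]integralE.
have mqE : measurable_fun setT (EFin \o q) by exact/measurable_EFinP.
congr (_ - _)%E.
- transitivity (\int[P]_w (EFin \o q)^\+%E (W w, W' w))%E.
    by apply: eq_integral => w _; rewrite !funeposE.
  rewrite exchange_integral ?funepos_ge0//; last exact: measurable_funepos.
  by apply: eq_integral => w _; rewrite !funeposE.
- transitivity (\int[P]_w (EFin \o q)^\-%E (W w, W' w))%E.
    by apply: eq_integral => w _; rewrite !funenegE.
  rewrite exchange_integral ?funeneg_ge0//; last exact: measurable_funeneg.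
  by apply: eq_integral => w _; rewrite !funenegE.
Qed.

End exchange.

Section level_sets.
Context d (T : measurableType d) (R : realType) (P : probability T R).

Lemma mean_sum (N : nat) (F : nat -> T -> R) : (forall k, rv_integrable P (F k)) ->
  rv_integrable P (fun w => \sum_(k < N) F k w) /\
  mean P (fun w => \sum_(k < N) F k w) = \sum_(k < N) mean P (F k).
Proof.
move=> iF; elim: N => [|N [iN mN]].
  split.
    by under eq_fun do rewrite big_ord0; exact: rv_integrable_cst.
  by rewrite big_ord0; under eq_mean => w do rewrite big_ord0; exact: mean_cst.
split; first by under eq_fun do rewrite big_ord_recr; exact: rv_integrableD.
rewrite big_ord_recr /= -mN -meanD//.
by apply: eq_mean => w; rewrite big_ord_recr.
Qed.

(** For every [n > 0], a bounded function of [W] is within [1 / n] of a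
    combination of finitely many indicators of its level sets: with
    [y := n (u + c) >= 0], the integer part of [y] takes finitely many values.
    If [D] has zero mean on every set [W^-1(B)], its mean against [u(W)] is
    therefore at most [E|D| / n]. *)
Lemma mean_level_sets_eq0 (W D : T -> R) (u : R -> R) (c : R) :
  measurable_fun setT W -> rv_integrable P D ->
  (forall B, measurable B -> mean P (fun w => \1_B (W w) * D w) = 0) ->
  measurable_fun setT u -> (forall x, `|u x| <= c) ->
  mean P (fun w => u (W w) * D w) = 0.
Proof.
move=> mW iD levD mu uc.
have m1 B : measurable B -> measurable_fun setT (fun w => \1_B (W w) : R).
  by move=> mB; apply: measurableT_comp => //; exact: measurable_indic.
have i1 B : measurable B -> rv_integrable P (fun w => \1_B (W w) * D w).
  move=> mB; apply: (@rv_integrable_bounded_mul _ _ _ _ 1) => //; first exact: m1.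
  by move=> w; rewrite indicE; case: (_ \in _); rewrite ?normr1 ?normr0.
have mD0 : mean P D = 0.
  rewrite -[RHS](levD setT)//; apply: eq_mean => w.
  by rewrite indicE in_setT mul1r.
suff approx n : `|mean P (fun w => u (W w) * D w)| <=
    n.+1%:R^-1 * mean P (fun w => `|D w|).
  set a := mean P _ in approx *; set b := mean P _ in approx.
  apply/eqP; rewrite -normr_eq0 eq_le normr_ge0 andbT leNgt; apply/negP => a0.
  have := approx (Num.truncn (b / `|a|)).
  by rewrite mulrC ler_pdivlMr// leNgt mulrC -ltr_pdivrMr// truncnS_gt.
pose y x := n.+1%:R * (u x + c).
have my : measurable_fun setT y.
  by apply: measurable_funM => //; exact: measurable_funD.
have y0 x : 0 <= y x.
  by rewrite mulr_ge0//; have := uc x; rewrite ler_norml; lra.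
pose N := (Num.truncn (n.+1%:R * (2 * c))).+1.
have yN x : (Num.truncn (y x) < N)%N.
  rewrite ltnS le_truncn// ler_pM2l//; have := uc x; rewrite ler_norml; lra.
pose A k := [set x | Num.truncn (y x) = k].
have mA k : measurable (A k).
  have -> : A k = y @^-1` `[k%:R, k.+1%:R[%classic.
    apply/seteqP; split=> x /=; rewrite /A /= in_itv /=.
      by move=> <-; exact: truncn_itv.
    by move=> /truncn_def.
  by rewrite -[X in measurable X]setTI; exact: my.
pose q x : R := (Num.truncn (y x))%:R.
have qE w : q (W w) * D w = \sum_(k < N) k%:R * (\1_(A k) (W w) * D w).
  rewrite (bigD1 (Ordinal (yN (W w))))//= big1 => [|k kN].
    by rewrite addr0 indicE mem_set// mul1r.
  rewrite indicE memNset ?mul0r ?mulr0//= /A /= => kE.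
  by move/eqP: kN; apply; apply: val_inj.
have [iq mq] := @mean_sum N (fun k w => k%:R * (\1_(A k) (W w) * D w))
  (fun k => rv_integrableZ _ (i1 _ (mA k))).
have {}iq : rv_integrable P (fun w => q (W w) * D w).
  by under eq_fun do rewrite qE.
have {}mq : mean P (fun w => q (W w) * D w) = 0.
  rewrite (eq_mean _ qE) mq big1// => k _.
  by rewrite meanZ ?levD ?mulr0//; exact: i1.
have mu1 : measurable_fun setT (fun w => u (W w)) by exact: measurableT_comp.
have iu : rv_integrable P (fun w => u (W w) * D w).
  exact: rv_integrable_bounded_mul (fun w => uc (W w)) iD.
have -> : mean P (fun w => u (W w) * D w) =
    mean P (fun w => u (W w) * D w - (n.+1%:R^-1 * (q (W w) * D w) - c * D w)).
  rewrite meanB//; last by apply: rv_integrableB; exact: rv_integrableZ.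
  by rewrite meanB ?meanZ//; [rewrite mq mD0; ring|exact: rv_integrableZ..].
have idf : rv_integrable P
    (fun w => u (W w) * D w - (n.+1%:R^-1 * (q (W w) * D w) - c * D w)).
  by apply: rv_integrableB => //; apply: rv_integrableB; exact: rv_integrableZ.
apply: (le_trans (le_norm_mean idf)).
rewrite -meanZ; last exact: rv_integrable_norm.
apply: le_mean; [exact: rv_integrable_norm|exact/rv_integrableZ/rv_integrable_norm|move=> w].
have n0 : (0 : R) < n.+1%:R by [].
have -> : u (W w) * D w - (n.+1%:R^-1 * (q (W w) * D w) - c * D w) =
    n.+1%:R^-1 * (y (W w) - q (W w)) * D w.
  by rewrite /y; field; lra.
rewrite normrM ler_wpM2r// normrM ger0_norm ?invr_ge0 ?ler0n//.
rewrite ler_piMr ?invr_ge0 ?ler0n//.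
have /andP[] := truncn_itv (y0 (W w)); rewrite -/(q _) -natr1 ler_norml -/(q _).
by rewrite /q; lra.
Qed.

Lemma mean_indic (B : set T) (Y : T -> R) : measurable B -> rv_integrable P Y ->
  (mean P (fun w => \1_B w * Y w))%:E = (\int[P]_(w in B) (Y w)%:E)%E.
Proof.
move=> mB iY.
rewrite EFin_mean; last first.
  apply: (@rv_integrable_bounded_mul _ _ _ _ 1) => //.
  by move=> w; rewrite indicE; case: (_ \in _); rewrite ?normr1 ?normr0.
rewrite [RHS]integral_mkcond; apply: eq_integral => w _.
by rewrite /patch indicE; case: ifPn => _; rewrite ?mul1r ?mul0r.
Qed.

End level_sets.

Section conditional_expectation.
Context d d' (T : measurableType d) (T' : measurableType d') (R : realType).
Variables (P : probability T R) (X : T -> T') (Y : T -> R) (V : T -> \bar R).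
Hypotheses (mX : measurable_fun setT X) (YV : is_cond_expectation P X Y V).

Lemma preimage_measurable A : g_sigma_algebra_preimage X A -> measurable A.
Proof. by move=> [B mB <-]; exact: mX. Qed.

Lemma cond_exp_measurable : measurable_fun setT V.
Proof.
case: YV => _ _ mV _ _ B mB; apply: preimage_measurable.
exact: mV.
Qed.

(** A nonnegative [Y] has the same total integral as [V]. *)
Lemma cond_exp_integrable : P.-integrable setT V -> rv_integrable P Y.
Proof.
case: YV => mY [//|Y0] _ VE iV; apply/integrableP; split.
  exact/measurable_EFinP.
have setX : g_sigma_algebra_preimage X setT.
  by exists setT => //; rewrite preimage_setT setTI.
under eq_integral => w _ do rewrite /= ger0_norm//.
rewrite -(VE _ setX) ltey_eq; apply/orP; left.
exact: integrable_fin_num iV.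
Qed.

Lemma fine_cond_exp_integrable : P.-integrable setT V -> rv_integrable P (fine \o V).
Proof.
move=> iV; apply: (le_integrable measurableT _ _ iV).
  apply/measurable_EFinP; apply: measurableT_comp => //.
  exact: cond_exp_measurable.
by move=> w _ /=; case: (V w) => [r||] //=; exact: leey.
Qed.

(** The events [W^-1(B)] belong to the sigma-algebra of [X], so [Y - V] has
    zero mean on each of them. *)
Lemma cond_exp_mean (W : T -> R) (phi : T' -> R) (u : R -> R) (c : R) :
  measurable_fun setT phi -> (forall w, W w = phi (X w)) ->
  P.-integrable setT V -> measurable_fun setT u -> (forall x, `|u x| <= c) ->
  mean P (fun w => u (W w) * Y w) = mean P (fun w => u (W w) * fine (V w)).
Proof.
move=> mphi WX iV mu uc.
have mW : measurable_fun setT W.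
  have -> : W = phi \o X by apply/funext.
  exact: measurableT_comp.
have iY := cond_exp_integrable iV; have iVf := fine_cond_exp_integrable iV.
have muW : measurable_fun setT (fun w => u (W w)) by exact: measurableT_comp.
apply/eqP; rewrite -subr_eq0 -meanB; last first.
- exact: rv_integrable_bounded_mul (fun w => uc (W w)) iVf.
- exact: rv_integrable_bounded_mul (fun w => uc (W w)) iY.
rewrite (eq_mean P (Y := fun w => u (W w) * (Y w - fine (V w)))); last first.
  by move=> w; rewrite mulrBr.
apply/eqP; apply: (mean_level_sets_eq0 mW (rv_integrableB iY iVf) _ mu uc) => B mB.
have m1 : measurable_fun setT (fun w => \1_B (W w) : R).
  by apply: measurableT_comp => //; exact: measurable_indic.
have c1 w : `|\1_B (W w) : R| <= 1.
  by rewrite indicE; case: (_ \in _); rewrite ?normr1 ?normr0.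
rewrite (eq_mean P (Y := fun w => \1_B (W w) * Y w - \1_B (W w) * fine (V w))); last first.
  by move=> w; rewrite mulrBr.
rewrite meanB; [|exact: rv_integrable_bounded_mul c1 _|exact: rv_integrable_bounded_mul c1 _].
apply/eqP; rewrite subr_eq0 -eqe; apply/eqP.
have mA : measurable (W @^-1` B) by rewrite -[X in measurable X]setTI; exact: mW.
have A1 w : \1_B (W w) = \1_(W @^-1` B) w :> R by [].
under eq_mean => w do rewrite A1.
under [in RHS]eq_mean => w do rewrite A1.
rewrite !mean_indic//.
have XA : g_sigma_algebra_preimage X (W @^-1` B).
  exists (phi @^-1` B); first by rewrite -[X in measurable X]setTI; exact: mphi.
  by apply/seteqP; split=> w /=; rewrite WX // => -[].
case: YV => _ _ _ /(_ _ XA) <-.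
apply: ae_eq_integral => //.
- by apply: measurable_funTS; exact: cond_exp_measurable.
- by apply: measurable_funTS; exact: measurable_int iVf.
have := integrable_ae measurableT iV.
by apply: filterS => w /(_ I) Vw _; rewrite fineK.
Qed.

End conditional_expectation.

(** * The exchangeable pair argument *)

(** Equality of the conditional expectations given [W], expressed through test
    functions so that no version of either has to be chosen. *)
Definition same_projection d (T : measurableType d) (R : realType)
    (P : probability T R) (W Y V : T -> R) : Prop :=
  forall (u : R -> R) (c : R), measurable_fun setT u -> (forall x, `|u x| <= c) ->
  mean P (fun w => u (W w) * Y w) = mean P (fun w => u (W w) * V w).

Section stein_exchange.
Context d (T : measurableType d) (R : realType) (P : probability T R).
Variables (W W' Rem v1 v2 : T -> R) (Dstar : R * R -> R) (lambda : R).
Variables (g k f : R -> R) (B m : R).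
Let Delta w := W w - W' w.
Let DeltaS w := Dstar (W w, W' w).
Let h x := g x * f x.
Let psi x := h x + k x.
Let H x := h x - k x.
Hypotheses (mW : measurable_fun setT W) (mW' : measurable_fun setT W').
Hypothesis exW : exchangeable P W W'.
Hypothesis l0 : 0 < lambda.
Hypotheses (mg : measurable_fun setT g) (mk : measurable_fun setT k).
Hypotheses (B0 : 0 < B) (sol : stein_solution g k f B).
Hypothesis mD : measurable_fun setT Dstar.
Hypothesis symD : {ae P, forall w, Dstar (W w, W' w) = Dstar (W' w, W w)}.
Hypothesis domD : {ae P, forall w, `|Delta w| <= DeltaS w}.
Hypotheses (iG : rv_integrable P (fun w => g (W w) ^+ 2)) (iR : rv_integrable P Rem).
Hypothesis Gm : mean P (fun w => g (W w) ^+ 2) <= m.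
Hypothesis iD2 : rv_integrable P (fun w => Delta w ^+ 2).
Hypothesis iDD : rv_integrable P (fun w => Delta w * DeltaS w).
Hypothesis pD : same_projection P W Delta (fun w => lambda * (g (W w) + Rem w)).
Hypothesis p1 : same_projection P W (fun w => Delta w ^+ 2) v1.
Hypothesis p2 : same_projection P W (fun w => Delta w * DeltaS w) v2.
Hypothesis iv1 : rv_integrable P v1.
Let e1 w := 1 - (2 * lambda)^-1 * v1 w.
Hypothesis ie1 : rv_integrable P (fun w => e1 w ^+ 2).
Hypothesis mv2 : measurable_fun setT v2.
Hypothesis iv2 : rv_integrable P (fun w => v2 w ^+ 2).

Let mf : measurable_fun setT f.
Proof. apply: continuous_measurable_fun; exact: (sol_cont sol). Qed.

Let mh : measurable_fun setT h.
Proof. exact: measurable_funM. Qed.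

Let mpsi : measurable_fun setT psi.
Proof. exact: measurable_funD. Qed.

Let mH : measurable_fun setT H.
Proof. exact: measurable_funB. Qed.

Let fB x : `|f x| <= B.
Proof. by rewrite ger0_norm ?(sol_ge0 sol)// (sol_le sol). Qed.

Let psi2 x : `|psi x| <= 2.
Proof. exact: le_trans (ler_normD _ _) (sol_le2 sol x). Qed.

Let H2 x : `|H x| <= 2.
Proof. exact: le_trans (ler_normB _ _) (sol_le2 sol x). Qed.

Let psi_growth x : `|psi x| <= B * (1 + `|g x|).
Proof. exact: le_trans (ler_normD _ _) (sol_growth sol x). Qed.

Let H_growth x : `|H x| <= B * (1 + `|g x|).
Proof. exact: le_trans (ler_normB _ _) (sol_growth sol x). Qed.

Let meas_W (u : R -> R) : measurable_fun setT u -> measurable_fun setT (fun w => u (W w)).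
Proof. by move=> mu; exact: measurableT_comp. Qed.

Let m_ge0 : 0 <= m.
Proof. by apply: le_trans Gm; apply: mean_ge0 => w; exact: sqr_ge0. Qed.

(** The weight B * (2 + m) dominates the L2 norm of any function of W that
   grows at most like B * (1 + |g|). *)
Lemma mean_growth_le (u : R -> R) (v : T -> R) : measurable_fun setT u ->
  (forall x, `|u x| <= B * (1 + `|g x|)) ->
  measurable_fun setT v -> rv_integrable P (fun w => v w ^+ 2) ->
  `|mean P (fun w => u (W w) * v w)| <=
    B * (2 + m) * Num.sqrt (mean P (fun w => v w ^+ 2)).
Proof.
move=> mu ug mv iv.
have dom w : `|u (W w) ^+ 2| <= B ^+ 2 * (2 + 2 * g (W w) ^+ 2).
  rewrite ger0_norm ?sqr_ge0// -real_normK ?num_real//.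
  apply: (@le_trans _ _ ((B * (1 + `|g (W w)|)) ^+ 2)).
    by rewrite lerXn2r// nnegrE mulr_ge0// ?(ltW B0)// addr_ge0.
  rewrite exprMn ler_wpM2l ?sqr_ge0// -(@real_normK _ (g _)) ?num_real//.
  by have := sqr_ge0 (1 - `|g (W w)|); lra.
have idom : rv_integrable P (fun w => B ^+ 2 * (2 + 2 * g (W w) ^+ 2)).
  by apply: rv_integrableZ; apply: rv_integrableD (rv_integrable_cst _ _) _; exact: rv_integrableZ.
have iu : rv_integrable P (fun w => u (W w) ^+ 2).
  by apply: rv_integrable_le dom idom; apply: measurable_funX; exact: meas_W.
apply: cauchy_schwarz => //; first exact: meas_W.
  by rewrite mulr_gt0//; have := m_ge0; lra.
apply: (@le_trans _ _ (mean P (fun w => B ^+ 2 * (2 + 2 * g (W w) ^+ 2)))).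
  by apply: le_mean => // w; exact: le_trans (ler_norm _) (dom w).
rewrite meanZ; last by apply: rv_integrableD (rv_integrable_cst _ _) _; exact: rv_integrableZ.
rewrite exprMn ler_wpM2l ?sqr_ge0//.
rewrite (meanD (rv_integrable_cst P 2)); last exact: rv_integrableZ.
rewrite (mean_cst P 2) meanZ//.
by have := Gm; have := m_ge0; have := sqr_ge0 m; lra.
Qed.

Let mDelta : measurable_fun setT Delta.
Proof. exact: measurable_funB. Qed.

Let iDelta : rv_integrable P Delta.
Proof. exact: rv_integrable_sqr. Qed.

(** Swapping [W] and [W'] changes the sign of [q], so the two halves of the
    left side are equal. *)
Lemma antisymmetric_mean (q : R * R -> R) (u : R -> R) (c : R) :
  measurable_fun setT q -> rv_integrable P (fun w => q (W w, W' w)) ->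
  {ae P, forall w, q (W' w, W w) = - q (W w, W' w)} ->
  measurable_fun setT u -> (forall x, `|u x| <= c) ->
  mean P (fun w => (u (W w) - u (W' w)) * q (W w, W' w)) =
  2 * mean P (fun w => u (W w) * q (W w, W' w)).
Proof.
move=> mq iq aq mu uc.
have mqW' : measurable_fun setT (fun w => q (W' w, W w)).
  by apply: (measurableT_comp mq); exact: measurable_fun_pair.
have muW := meas_W mu.
have muW' : measurable_fun setT (fun w => u (W' w)) by exact: measurableT_comp.
have iuq := rv_integrable_bounded_mul muW (fun w => uc (W w)) iq.
have iuq' := rv_integrable_bounded_mul muW' (fun w => uc (W' w)) iq.
have swap : mean P (fun w => u (W' w) * q (W w, W' w)) =
    - mean P (fun w => u (W w) * q (W w, W' w)).
  rewrite (@exchange_mean _ _ _ P W W' mW mW' exW (fun x => u x.2 * q x)); last first.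
    by apply: measurable_funM => //; exact: measurableT_comp.
  rewrite /= -mulN1r -meanZ//.
  apply: ae_eq_mean.
  - exact: measurable_funM.
  - by apply: measurable_funM => //; exact: (rv_integrable_measurable iuq).
  - by apply: filterS aq => w /= ->; rewrite mulrN mulN1r.
rewrite (eq_mean P (Y := fun w => u (W w) * q (W w, W' w) - u (W' w) * q (W w, W' w))).
  by rewrite meanB// swap; ring.
by move=> w; rewrite mulrBl.
Qed.

Let remainder w := f (W w) - f (W' w) - Delta w * psi (W w).

(** The first-order Taylor remainder of [f] is dominated through [sol_incr] by
    an increment of [H]; as [|Delta|] is at most the symmetric [DeltaS], the
    bound is again an antisymmetric mean. *)
Lemma stein_remainder_le : rv_integrable P (fun w => remainder w * Delta w) /\
  `|mean P (fun w => remainder w * Delta w)| <= 2 * mean P (fun w => H (W w) * v2 w).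
Proof.
have mfW := meas_W mf; have mHW := meas_W mH; have mpsiW := meas_W mpsi.
have mfW' : measurable_fun setT (fun w => f (W' w)) by exact: measurableT_comp.
have mHW' : measurable_fun setT (fun w => H (W' w)) by exact: measurableT_comp.
have mrem : measurable_fun setT remainder.
  by apply: measurable_funB; [exact: measurable_funB|exact: measurable_funM].
have iHD : rv_integrable P (fun w => (H (W w) - H (W' w)) * (Delta w * DeltaS w)).
  apply: (@rv_integrable_bounded_mul _ _ _ _ 4) => //; first exact: measurable_funB.
  move=> w; apply: le_trans (ler_normB _ _) _.
  by have := H2 (W w); have := H2 (W' w); lra.
have i4 : rv_integrable P (fun w => (2 * B) * `|Delta w| + 2 * Delta w ^+ 2).
  by apply: rv_integrableD; apply: rv_integrableZ => //; exact: rv_integrable_norm.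
have irem : rv_integrable P (fun w => remainder w * Delta w).
  apply: rv_integrable_le i4; first exact: measurable_funM.
  move=> w; rewrite normrM.
  have rw : `|remainder w| <= 2 * B + 2 * `|Delta w|.
    rewrite /remainder; apply: le_trans (ler_normB _ _) _; apply: lerD.
      by apply: le_trans (ler_normB _ _) _; have := fB (W w); have := fB (W' w); lra.
    by rewrite normrM mulrC ler_wpM2r.
  apply: le_trans (ler_wpM2r _ rw) _ => //.
  by rewrite -(@real_normK _ (Delta w)) ?num_real//; lra.
split => //.
apply: le_trans (le_norm_mean irem) _.
have -> : 2 * mean P (fun w => H (W w) * v2 w) =
    mean P (fun w => (H (W w) - H (W' w)) * (Delta w * DeltaS w)).
  rewrite -(p2 mH H2).
  rewrite (@antisymmetric_mean (fun x => (x.1 - x.2) * Dstar x) H 2)//.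
    by apply: measurable_funM => //; exact: measurable_funB.
  by apply: filterS symD => w /= ->; rewrite -mulNr opprB.
apply: ae_le_mean => //; first exact: rv_integrable_norm.
apply: filterS domD => w /= dom.
rewrite normrM.
have := sol_incr sol (W w) (W' w).
rewrite -/(h (W w)) -/(h (W' w)) -/(psi (W w)) -/(H (W w)) -/(H (W' w)) -/(Delta w) -/(remainder w).
move=> inc; apply: le_trans (ler_pM (normr_ge0 _) (normr_ge0 _) inc dom) _.
by rewrite /Delta; lra.
Qed.

(** The decomposition
    [E k(W) = E (psi(W) e1) - E (remainder * Delta) / (2 lambda) + E (f(W) Rem)],
    where [psi = h + k] is the derivative of [f]. *)
Lemma stein_exchange_bound :
  `|mean P (fun w => k (W w))| <=
    B * (2 + m) * Num.sqrt (mean P (fun w => e1 w ^+ 2)) +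
    lambda^-1 * (B * (2 + m) * Num.sqrt (mean P (fun w => v2 w ^+ 2))) +
    B * mean P (fun w => `|Rem w|).
Proof.
have mfW := meas_W mf; have mHW := meas_W mH; have mpsiW := meas_W mpsi.
have [irem remainder_le] := stein_remainder_le.
have me1 : measurable_fun setT e1.
  apply: measurable_funB => //; apply: measurable_funM => //.
  exact: (rv_integrable_measurable iv1).
have iGW : rv_integrable P (fun w => g (W w)) by apply: rv_integrable_sqr => //; exact: meas_W.
have ifG : rv_integrable P (fun w => f (W w) * g (W w)).
  exact: rv_integrable_bounded_mul (fun w => fB (W w)) iGW.
have ifR : rv_integrable P (fun w => f (W w) * Rem w).
  exact: rv_integrable_bounded_mul (fun w => fB (W w)) iR.
have ipsi : rv_integrable P (fun w => psi (W w)).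
  by apply: rv_integrable_le (rv_integrable_cst _ 2) => // w; exact: psi2.
have iv1e : rv_integrable P e1.
  by apply: rv_integrableB; [exact: rv_integrable_cst|exact: rv_integrableZ].
have ipD : rv_integrable P (fun w => psi (W w) * Delta w ^+ 2).
  exact: rv_integrable_bounded_mul (fun w => psi2 (W w)) iD2.
have ipv : rv_integrable P (fun w => psi (W w) * v1 w).
  exact: rv_integrable_bounded_mul (fun w => psi2 (W w)) iv1.
have Ek : mean P (fun w => k (W w)) =
    mean P (fun w => psi (W w)) - mean P (fun w => f (W w) * g (W w)).
  rewrite -meanB//; apply: eq_mean => w; rewrite /psi /h; ring.
have EfD : mean P (fun w => f (W w) * Delta w) =
    lambda * (mean P (fun w => f (W w) * g (W w)) + mean P (fun w => f (W w) * Rem w)).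
  rewrite (pD mf fB) -meanD// -meanZ; last exact: rv_integrableD.
  by apply: eq_mean => w; ring.
have Eanti : 2 * mean P (fun w => f (W w) * Delta w) =
    mean P (fun w => psi (W w) * v1 w) + mean P (fun w => remainder w * Delta w).
  rewrite -(p1 mpsi psi2) -meanD//.
  rewrite -(@antisymmetric_mean (fun x => x.1 - x.2) f B)//=.
  - by apply: eq_mean => w; rewrite /remainder -/(Delta w); ring.
  - exact: measurable_funB.
  - by apply: aeW => w /=; rewrite opprB.
have Epsi : mean P (fun w => psi (W w) * e1 w) =
    mean P (fun w => psi (W w)) - (2 * lambda)^-1 * mean P (fun w => psi (W w) * v1 w).
  rewrite -meanZ// -meanB//; last exact: rv_integrableZ.
  by apply: eq_mean => w; rewrite /e1; ring.
have Bpsi := mean_growth_le mpsi psi_growth me1 ie1.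
have BH := mean_growth_le mH H_growth mv2 iv2.
have BR : `|mean P (fun w => f (W w) * Rem w)| <= B * mean P (fun w => `|Rem w|).
  apply: le_trans (le_norm_mean ifR) _; rewrite -meanZ; last exact: rv_integrable_norm.
  apply: le_mean; [exact: rv_integrable_norm|exact/rv_integrableZ/rv_integrable_norm|move=> w].
  by rewrite normrM ler_wpM2r.
set a := mean P (fun w => psi (W w) * e1 w) in Epsi Bpsi.
set r := mean P (fun w => remainder w * Delta w) in Eanti remainder_le.
set fr := mean P (fun w => f (W w) * Rem w) in EfD BR.
have -> : mean P (fun w => k (W w)) = a - (2 * lambda)^-1 * r + fr.
  rewrite Ek Epsi.
  have -> : mean P (fun w => f (W w) * g (W w)) =
    lambda^-1 * mean P (fun w => f (W w) * Delta w) - fr.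
    by rewrite EfD; field; rewrite gt_eqF.
  have -> : mean P (fun w => f (W w) * Delta w) =
    2^-1 * (mean P (fun w => psi (W w) * v1 w) + r) by rewrite -Eanti; field.
  by field; rewrite gt_eqF.
apply: le_trans (ler_normD _ _) _; apply: lerD => //.
apply: le_trans (ler_normB _ _) _; apply: lerD => //.
rewrite normrM ger0_norm; last by rewrite invr_ge0 mulr_ge0 ?(ltW l0).
have -> : (2 * lambda)^-1 = lambda^-1 * 2^-1 by field; rewrite gt_eqF.
rewrite -[X in X <= _]mulrA ler_wpM2l ?invr_ge0 ?(ltW l0)//.
by have := le_trans (ler_norm _) BH; lra.
Qed.

End stein_exchange.

(** * Passage from extended real to real expectations *)
Section ereal_bookkeeping.
Context d (T : measurableType d) (R : realType) (P : probability T R).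

Lemma ae_eq_rv_integrable (U : T -> \bar R) (Y : T -> R) :
  measurable_fun setT U -> rv_integrable P Y ->
  {ae P, forall w, U w = (Y w)%:E} -> P.-integrable setT U.
Proof.
move=> mU iY UY; apply/integrableP; split => //.
have /integrableP[mY] := iY; congr (_ < _)%E.
apply: ae_eq_integral => //; try exact: measurableT_comp.
by apply: filterS UY => w /= -> _.
Qed.

Lemma sqre_measurable (U : T -> \bar R) : measurable_fun setT U ->
  measurable_fun setT (fun w => `|U w| ^+ 2)%E.
Proof.
move=> mU; under eq_fun do rewrite expe2.
by apply: emeasurable_funM; exact: measurableT_comp.
Qed.

Lemma sqre_integrable (U : T -> \bar R) : measurable_fun setT U ->
  (\int[P]_w (`|U w| ^+ 2) < +oo)%E -> P.-integrable setT U.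
Proof.
move=> mU U2.
have i2 : P.-integrable setT (fun w => `|U w| ^+ 2 + 1)%E.
  apply: integrableD => //; last exact: (@finite_measure_integrable_cst _ _ _ P setT 1).
  apply/integrableP; split; first exact: sqre_measurable.
  by under eq_integral => w _ do rewrite gee0_abs ?expe_ge0 ?abse_ge0//.
apply: (le_integrable measurableT mU _ i2) => w _.
rewrite [leRHS]gee0_abs; last by rewrite adde_ge0// expe_ge0 ?abse_ge0.
case: (U w) => [r||]; last 2 first.
- by rewrite expe2 /= mulyy addye// leey.
- by rewrite expe2 /= mulyy addye// leey.
rewrite (_ : (`|r%:E| ^+ 2 + 1 = (`|r| ^+ 2 + 1)%:E)%E); last by rewrite EFinD EFin_expe.
by rewrite lee_fin; have := normr_ge0 r; nra.
Qed.

Lemma mean_sqr_fine (U : T -> \bar R) (Y : T -> R) :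
  measurable_fun setT U -> measurable_fun setT Y ->
  {ae P, forall w, U w = (Y w)%:E} -> (\int[P]_w (`|U w| ^+ 2) < +oo)%E ->
  rv_integrable P (fun w => Y w ^+ 2) /\
  ((mean P (fun w => Y w ^+ 2))%:E = \int[P]_w (`|U w| ^+ 2))%E.
Proof.
move=> mU mY UY U2.
have E : (\int[P]_w (`|U w| ^+ 2) = \int[P]_w (Y w ^+ 2)%:E)%E.
  apply: ae_eq_integral => //.
  - exact: sqre_measurable.
  - by apply/measurable_EFinP; exact: measurable_funX.
  - by apply: filterS UY => w UYw _; rewrite /= UYw /= -EFinM -expr2 real_normK ?num_real.
have iY : rv_integrable P (fun w => Y w ^+ 2).
  apply/integrableP; split; first by apply/measurable_EFinP; exact: measurable_funX.
  by under eq_integral => w _ do rewrite /= ger0_norm ?sqr_ge0//; rewrite -E.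
by split => //; rewrite EFin_mean.
Qed.

Lemma mean_half_line (W : T -> R) (z : R) : measurable_fun setT W ->
  rv_integrable P (fun w => half_line true z (W w)) /\
  (P [set w | (W w <= z)%R] = (mean P (fun w => half_line true z (W w)))%:E)%E.
Proof.
move=> mW.
have mA : measurable [set w | (W w <= z)%R].
  have -> : [set w | (W w <= z)%R] = W @^-1` `]-oo, z].
    by apply/seteqP; split=> w /=; rewrite in_itv.
  by rewrite -[X in measurable X]setTI; exact: mW.
have kE : (fun w => half_line true z (W w)) = \1_[set w | (W w <= z)%R].
  apply/funext => w; rewrite /half_line indicE /=.
  suff -> : (w \in [set w | (W w <= z)%R]) = (W w <= z) by [].
  by apply/idP/idP; rewrite inE.
have ik : rv_integrable P (fun w => half_line true z (W w)).
  rewrite kE; apply: rv_integrable_le (rv_integrable_cst _ 1) => // w.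
  by rewrite indicE; case: (_ \in _); rewrite ?normr1 ?normr0.
split => //; rewrite EFin_mean//.
under eq_integral => w _ do rewrite (congr1 (@^~ w) kE).
by rewrite integral_indic// setIT.
Qed.

End ereal_bookkeeping.

Lemma weighted_sum_infty (R : realType) (k : R) (a b c : \bar R) : 0 < k ->
  (0 <= a)%E -> (0 <= b)%E -> (0 <= c)%E -> a = +oo%E \/ b = +oo%E \/ c = +oo%E ->
  (k%:E * (a + b + c))%E = +oo%E.
Proof.
move=> k0 a0 b0 c0 abc.
suff -> : (a + b + c = +oo)%E by rewrite gt0_muley.
case: abc => [ay|[by_|cy]]; subst.
- by rewrite -addeA addye// gt_eqF// (lt_le_trans _ (adde_ge0 b0 c0)).
- by rewrite [(a + _)%E]addey ?addye// gt_eqF// (lt_le_trans _ a0, lt_le_trans _ c0).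
- by rewrite addey// gt_eqF// (lt_le_trans _ (adde_ge0 a0 b0)).
Qed.

Theorem theorem2p1 (R : realType) (g : R -> R) (c1 tau : R)
  (gC2 : class_C2 g) (hc1 : normalizing g c1)
  (hA1 : condA1 g) (hA2 : condA2 g) (hA3 : condA3 g c1) (hA4 : condA4 g tau)
  (m : R) :
  exists C : R,
  forall (d : measure_display) (T : measurableType d) (P : probability T R)
    (n : nat) (X : {RV P >-> n.-tuple R}) (phi : {mfun n.-tuple R >-> R})
    (W W' : {RV P >-> R}) (Rem : {RV P >-> R}) (lambda : R)
    (Dstar : R * R -> R),
  (forall w, W w = phi (X w)) ->
  exchangeable P W W' ->
  let Delta := fun w => W w - W' w in
  let DeltaS := fun w => Dstar (W w, W' w) in
  0 < lambda < 1 ->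
  (exists2 Z : T -> \bar R,
     is_cond_expectation P X Delta Z &
     {ae P, forall w, Z w = (lambda * (g (W w) + Rem w))%:E}) ->
  ('E_P[fun w => ((g (W w)) ^+ 2)%R] = m%:E)%E ->
  measurable_fun [set: R * R] Dstar ->
  {ae P, forall w, Dstar (W w, W' w) = Dstar (W' w, W w)} ->
  {ae P, forall w, `|Delta w| <= DeltaS w} ->
  forall V1 V2 : T -> \bar R,
  is_cond_expectation P X (fun w => (Delta w) ^+ 2) V1 ->
  is_cond_expectation P X (fun w => Delta w * DeltaS w) V2 ->
  forall z : R,
  (`|P [set w | (W w <= z)%R] - (distr_fun g c1 z)%:E| <=
   (C / (1 + `|g z|))%:E *
   (sqrte (\int[P]_w (`|1 - ((2 * lambda)^-1)%:E * V1 w| ^+ 2))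
    + (lambda^-1)%:E * sqrte (\int[P]_w (`|V2 w| ^+ 2))
    + 'E_P[fun w => `|Rem w|%R]))%E.
Proof.
have [K S] := stein_setup_density gC2 hc1 hA1 hA2 hA4.
have [C0 C00 sol] := stein_solution_exists S.
exists (C0 * (2 + `|m|)).
move=> d T P n X phi W W' Rem lambda Dstar WX exW Delta DeltaS /andP[l0 l1].
move=> [Z hZ ZE] Em mD symD domD V1 V2 hV1 hV2 z.
have [f fsol] := sol z.
set B := C0 / (1 + `|g z|) in fsol.
have gz0 : 0 < 1 + `|g z| by rewrite ltr_pwDl.
have B0 : 0 < B by rewrite divr_gt0.
have -> : C0 * (2 + `|m|) / (1 + `|g z|) = B * (2 + `|m|) by rewrite /B mulrAC.
have BM0 : 0 < B * (2 + `|m|) by rewrite mulr_gt0// ltr_pwDl.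
have mX : measurable_fun setT X by [].
have mphi : measurable_fun setT phi by [].
have mW : measurable_fun setT W by [].
have mW' : measurable_fun setT W' by [].
have mRem : measurable_fun setT Rem by [].
have mg : measurable_fun setT g.
  apply: continuous_measurable_fun => x.
  by have [dg _ _] := gC2; apply/differentiable_continuous/derivable1_diffP/dg.
have mV1 : measurable_fun setT V1 := cond_exp_measurable mX hV1.
have mV2 : measurable_fun setT V2 := cond_exp_measurable mX hV2.
have mZ : measurable_fun setT Z := cond_exp_measurable mX hZ.
have mk : measurable_fun setT (fun w => half_line true z w - distr_fun g c1 z).
  by apply: measurable_funB => //; rewrite half_line_indic; exact: measurable_indic.
set I1 := (\int[P]_w (`|1 - ((2 * lambda)^-1)%:E * V1 w| ^+ 2))%E.
set I2 := (\int[P]_w (`|V2 w| ^+ 2))%E.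
have ER : ('E_P[fun w => `|Rem w|%R] = \int[P]_w (`|Rem w|)%:E)%E by rewrite unlock.
set I3 := ('E_P[fun w => `|Rem w|%R])%E in ER *.
have I30 : (0 <= I3)%E by rewrite ER; apply: integral_ge0 => w _; rewrite lee_fin.
have l0V : 0 < lambda^-1 by rewrite invr_gt0.
have l0E : (0 <= (lambda^-1)%:E * sqrte I2)%E.
  by rewrite mule_ge0 ?sqrte_ge0// lee_fin ltW.
(* If one of the three expectations is infinite, so is the right-hand side. *)
have infty := weighted_sum_infty BM0 (sqrte_ge0 I1) l0E I30.
have [I1y|I1f] := eqVneq I1 +oo%E.
  by rewrite infty ?leey//; left; rewrite I1y.
have [I2y|I2f] := eqVneq I2 +oo%E.
  by rewrite infty ?leey//; right; left; rewrite I2y gt0_muley.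
have [I3y|I3f] := eqVneq I3 +oo%E.
  by rewrite infty ?leey//; right; right.
rewrite -ltey in I1f; rewrite -ltey in I2f; rewrite -ltey in I3f.
pose c := (2 * lambda)^-1.
have c0 : 0 < c by rewrite invr_gt0 mulr_gt0.
have iR : rv_integrable P Rem.
  apply/integrableP; split; first exact/measurable_EFinP.
  by rewrite ER in I3f.
have iG : rv_integrable P (fun w => g (W w) ^+ 2).
  apply/integrableP; split.
    by apply/measurable_EFinP; apply: measurable_funX; exact: measurableT_comp.
  under eq_integral => w _ do rewrite /= ger0_norm ?sqr_ge0//.
  by move: Em; rewrite unlock => ->; rewrite ltry.
have Gm : mean P (fun w => g (W w) ^+ 2) = m.
  by apply/EFin_inj; rewrite EFin_mean// -Em unlock.
have m0 : 0 <= m by rewrite -Gm; apply: mean_ge0 => w; exact: sqr_ge0.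
pose E1 w := (1 - c%:E * V1 w)%E.
have mE1 : measurable_fun setT E1.
  by apply: emeasurable_funB => //; exact: measurable_funeM.
(* [V1] is recovered from [1 - V1 / (2 lambda)], which is square integrable. *)
have iE1 : P.-integrable setT E1 by exact: sqre_integrable.
have iV1 : P.-integrable setT V1.
  have iE1' : P.-integrable setT (fun w => (2 * lambda)%:E * (1 - E1 w))%E.
    apply: integrableZl => //; apply: integrableB => //.
    exact: (@finite_measure_integrable_cst _ _ _ P setT 1).
  apply: eq_integrable iE1' => // w _; rewrite /E1.
  have cl : 2 * lambda * c = 1 by rewrite /c mulfV// gt_eqF// mulr_gt0.
  case: (V1 w) => [r||].
  - have -> : ((2 * lambda)%:E * (1 - (1 - c%:E * r%:E)) =
        (2 * lambda * (1 - (1 - c * r)))%:E)%E by [].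
    by rewrite opprB addrCA subrr addr0 mulrA cl mul1r.
  - by rewrite gt0_muley// addeNy gt0_muley// lte_fin mulr_gt0.
  - by rewrite gt0_muleNy//= gt0_muleNy// lte_fin mulr_gt0.
have iV2 : P.-integrable setT V2 by exact: sqre_integrable.
have iD2 := cond_exp_integrable hV1 iV1.
have iDD := cond_exp_integrable hV2 iV2.
have mG : measurable_fun setT (fun w => g (W w)) by exact: measurableT_comp.
have iZr : rv_integrable P (fun w => lambda * (g (W w) + Rem w)).
  by apply: rv_integrableZ; apply: rv_integrableD => //; exact: rv_integrable_sqr.
have iZ : P.-integrable setT Z := ae_eq_rv_integrable mZ iZr ZE.
have pD : same_projection P W Delta (fun w => lambda * (g (W w) + Rem w)).
  move=> u b mu ub; rewrite (cond_exp_mean mX hZ mphi WX iZ mu ub).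
  apply: ae_eq_mean.
  - apply: measurable_funM; first exact: measurableT_comp.
    exact: rv_integrable_measurable (fine_cond_exp_integrable mX hZ iZ).
  - apply: measurable_funM; first exact: measurableT_comp.
    exact: rv_integrable_measurable iZr.
  - by apply: filterS ZE => w /= ->.
have p1 : same_projection P W (fun w => Delta w ^+ 2) (fine \o V1).
  by move=> u b mu ub; exact: (cond_exp_mean mX hV1 mphi WX iV1 mu ub).
have p2 : same_projection P W (fun w => Delta w * DeltaS w) (fine \o V2).
  by move=> u b mu ub; exact: (cond_exp_mean mX hV2 mphi WX iV2 mu ub).
have iv1 := fine_cond_exp_integrable mX hV1 iV1.
have iv2 := fine_cond_exp_integrable mX hV2 iV2.
have V1fin := integrable_ae measurableT iV1.
have V2fin := integrable_ae measurableT iV2.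
have [] := @mean_sqr_fine _ _ _ P E1 (fun w => 1 - c * (fine \o V1) w) mE1.
- by apply: measurable_funB => //; apply: measurable_funM => //; exact: rv_integrable_measurable iv1.
- apply: filterS V1fin => w /(_ I) Vw.
  by rewrite /E1 -[in LHS](fineK Vw).
- by [].
move=> ie1 I1E.
have [] := @mean_sqr_fine _ _ _ P V2 (fine \o V2) mV2 (rv_integrable_measurable iv2).
- by apply: filterS V2fin => w /(_ I) Vw; rewrite /= fineK.
- by [].
move=> iv22 I2E.
have I3E : I3 = (mean P (fun w => `|Rem w|))%:E.
  by rewrite ER EFin_mean//; exact: rv_integrable_norm.
rewrite /I1 -I1E /I2 -I2E I3E /=.
have [ik ->] := mean_half_line P z mW.
have main := @stein_exchange_bound _ _ _ P W W' Rem (fine \o V1) (fine \o V2) Dstar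
  lambda g _ f B m mW mW' exW l0 mg mk B0 fsol mD symD domD iG iR
  (eq_ind_r (fun x => x <= m) (lexx m) Gm) iD2 iDD pD p1 p2 iv1 ie1
  (rv_integrable_measurable iv2) iv22.
have Fk : mean P (fun w => half_line true z (W w) - distr_fun g c1 z) =
    mean P (fun w => half_line true z (W w)) - distr_fun g c1 z.
  rewrite (meanB ik (rv_integrable_cst P (distr_fun g c1 z))).
  by rewrite (mean_cst P (distr_fun g c1 z)).
suff real : `|mean P (fun w => half_line true z (W w)) - distr_fun g c1 z| <=
    B * (2 + `|m|) * (Num.sqrt (mean P (fun w => (1 - c * (fine \o V1) w) ^+ 2)) +
      lambda^-1 * Num.sqrt (mean P (fun w => (fine \o V2) w ^+ 2)) +
      mean P (fun w => `|Rem w|)).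
  by rewrite -lee_fin in real.
rewrite -Fk; apply: le_trans main _; rewrite (ger0_norm m0) -/c.
set s1 := Num.sqrt _; set s2 := Num.sqrt _.
have r0 : 0 <= mean P (fun w => `|Rem w|) by exact: mean_ge0.
have BM : B <= B * (2 + m) by rewrite ler_peMr ?(ltW B0)//; lra.
have := ler_wpM2r r0 BM; lra.
Qed.
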